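(* Let $\mathcal{O}$ be the fixed one-counter net described in the context. Then $\mathsf{CTL}$ model checking over $\mathcal{O}$, i.e. the problem of deciding for a given $\mathsf{CTL}$ formula $\varphi$ and a given state $(q,n)$ of $T(\mathcal{O})$ whether $(q,n)\in[\![\varphi]\!]_{T(\mathcal{O})}$, is $\mathsf{PSPACE}$-hard.
   Context: A one-counter net is a tuple $(Q,\{Q_p\},\delta_0,\delta_{>0})$ with $\delta_0\subseteq Q\times\{0,1\}\times Q$, $\delta_{>0}\subseteq Q\times\{-1,0,1\}\times Q$ and $\delta_0\subseteq\delta_{>0}$; its transition system $T(\cdot)$ has states $Q\times\mathbb{N}$, $(q,n)$ satisfies $p$ iff $q\in Q_p$, and $(q,n)\to(q',n+k)$ iff either $n=0$ and $(q,k,q')\in\delta_0$, or $n>0$ and $(q,k,q')\in\delta_{>0}$. $\mathsf{CTL}$ formulas $\varphi::=p\mid\neg\varphi\mid\varphi\wedge\varphi\mid\exists\mathsf{X}\varphi\mid\exists\varphi\mathsf{U}\varphi\mid\exists\varphi\mathsf{WU}\varphi$ have the standard semantics. The fixed net $\mathcal{O}$ has control locations $t,\bar t,q_0,q_1,q_2,q_3,f,g,p_0,p_1$; the atomic propositions are the control locations, each holding exactly at itself. $\delta_{>0}$ consists of $(q_0,-1,q_1)$, $(q_1,-1,q_2)$, $(q_2,-1,q_3)$, $(q_3,-1,q_0)$, $(q_1,-1,q_1)$, $(q_3,-1,q_3)$, $(q_0,0,t)$, $(t,0,q_0)$, $(q_2,0,t)$, $(q_1,0,\bar t)$, $(\bar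 t,0,q_1)$, $(\bar t,0,q_2)$, $(q_3,0,\bar t)$, $(\bar t,0,q_3)$, $(t,0,f)$, $(\bar t,-1,f)$, $(f,-1,g)$, $(g,-1,f)$, $(\bar t,1,p_1)$, $(p_1,1,p_1)$, $(p_1,0,\bar t)$, $(p_0,0,\bar t)$, $(\bar t,0,p_0)$; and $\delta_0=\{(\bar t,1,p_1),(p_0,0,\bar t),(\bar t,0,p_0),(t,0,q_0),(t,0,f)\}$. *)

(* Defs.v *)
From Stdlib Require Import ZArith.
From mathcomp Require Import all_boot.
From Stdlib Require List.

Set Implicit Arguments.
Unset Strict Implicit.
Unset Printing Implicit Defensive.

Inductive loc := Lt | Ltb | Lq0 | Lq1 | Lq2 | Lq3 | Lf | Lg | Lp0 | Lp1.

Definition delta_pos : list (loc * Z * loc) :=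
  [:: (Lq0, (-1)%Z, Lq1); (Lq1, (-1)%Z, Lq2); (Lq2, (-1)%Z, Lq3); (Lq3, (-1)%Z, Lq0);
      (Lq1, (-1)%Z, Lq1); (Lq3, (-1)%Z, Lq3);
      (Lq0, 0%Z, Lt); (Lt, 0%Z, Lq0); (Lq2, 0%Z, Lt);
      (Lq1, 0%Z, Ltb); (Ltb, 0%Z, Lq1); (Ltb, 0%Z, Lq2);
      (Lq3, 0%Z, Ltb); (Ltb, 0%Z, Lq3);
      (Lt, 0%Z, Lf); (Ltb, (-1)%Z, Lf); (Lf, (-1)%Z, Lg); (Lg, (-1)%Z, Lf);
      (Ltb, 1%Z, Lp1); (Lp1, 1%Z, Lp1); (Lp1, 0%Z, Ltb);
      (Lp0, 0%Z, Ltb); (Ltb, 0%Z, Lp0)].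

Definition delta_zero : list (loc * Z * loc) :=
  [:: (Ltb, 1%Z, Lp1); (Lp0, 0%Z, Ltb); (Ltb, 0%Z, Lp0); (Lt, 0%Z, Lq0); (Lt, 0%Z, Lf)].

Definition ocn_state := (loc * nat)%type.

Definition ocn_step (c c' : ocn_state) : Prop :=
  exists k : Z, Z.of_nat c'.2 = (Z.of_nat c.2 + k)%Z /\
    ((c.2 = 0 /\ List.In (c.1, k, c'.1) delta_zero) \/
     (0 < c.2 /\ List.In (c.1, k, c'.1) delta_pos)).

Inductive ctl :=
| CAtom of loc
| CNeg of ctl
| CAnd of ctl & ctl
| CEX of ctl
| CEU of ctl & ctl
| CEWU of ctl & ctl.

Fixpoint sat (phi : ctl) (c : ocn_state) : Prop :=
  match phi with
  | CAtom p => c.1 = p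
  | CNeg a => ~ sat a c
  | CAnd a b => sat a c /\ sat b c
  | CEX a => exists c', ocn_step c c' /\ sat a c'
  | CEU a b =>
      exists (m : nat) (pi : nat -> ocn_state),
        pi 0 = c /\ (forall i, i < m -> ocn_step (pi i) (pi i.+1)) /\
        sat b (pi m) /\ (forall i, i < m -> sat a (pi i))
  | CEWU a b =>
      (exists (m : nat) (pi : nat -> ocn_state),
        pi 0 = c /\ (forall i, i < m -> ocn_step (pi i) (pi i.+1)) /\
        sat b (pi m) /\ (forall i, i < m -> sat a (pi i)))
      \/
      (exists pi : nat -> ocn_state,
        pi 0 = c /\ (forall i, ocn_step (pi i) (pi i.+1)) /\
        (forall i, sat a (pi i)))
  end.

Definition loc_code (q : loc) : nat :=
  match q with
  | Lt => 0 | Ltb => 1 | Lq0 => 2 | Lq1 => 3 | Lq2 => 4 | Lq3 => 5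
  | Lf => 6 | Lg => 7 | Lp0 => 8 | Lp1 => 9
  end.

Definition enc_unary (k : nat) : seq bool := nseq k true ++ [:: false].

(* bits after the leading 1, most significant first; each bit b as [true; b] *)
Fixpoint enc_pos (p : positive) : seq bool :=
  match p with
  | xH => [::]
  | xO p' => enc_pos p' ++ [:: true; false]
  | xI p' => enc_pos p' ++ [:: true; true]
  end.

(* self-delimiting binary encoding of a natural number *)
Definition enc_nat (n : nat) : seq bool :=
  match N.of_nat n with
  | N0 => [:: false]
  | Npos p => [:: true; true] ++ enc_pos p ++ [:: false]
  end.

Fixpoint enc_ctl (phi : ctl) : seq bool :=
  match phi with
  | CAtom p => [:: false; false; false] ++ enc_unary (loc_code p)
  | CNeg a => [:: false; false; true] ++ enc_ctl a
  | CAnd a b => [:: false; true; false] ++ enc_ctl a ++ enc_ctl b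
  | CEX a => [:: false; true; true] ++ enc_ctl a
  | CEU a b => [:: true; false; false] ++ enc_ctl a ++ enc_ctl b
  | CEWU a b => [:: true; false; true] ++ enc_ctl a ++ enc_ctl b
  end.

Definition enc_instance (phi : ctl) (q : loc) (n : nat) : seq bool :=
  enc_unary (loc_code q) ++ enc_nat n ++ enc_ctl phi.

Definition CTL_MC (w : seq bool) : Prop :=
  exists (phi : ctl) (q : loc) (n : nat),
    w = enc_instance phi q n /\ sat phi (q, n).

Inductive move := MLeft | MStay | MRight.

Record TM := {
  tm_state : finType;
  tm_sym : finType;
  tm_blank : tm_sym;
  tm_inp : bool -> tm_sym;
  tm_start : tm_state;
  tm_acc : tm_state;
  tm_rej : tm_state;
  tm_delta : tm_state -> tm_sym -> tm_state * tm_sym * move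
}.

(* configuration: state, reversed left part, head symbol, right part
   (two-way infinite tape; the lists hold the visited cells) *)
Record cfg (M : TM) := Cfg {
  cf_st : tm_state M;
  cf_left : seq (tm_sym M);
  cf_head : tm_sym M;
  cf_right : seq (tm_sym M)
}.

Definition halted (M : TM) (c : cfg M) : bool :=
  (cf_st c == tm_acc M) || (cf_st c == tm_rej M).

Definition tm_step (M : TM) (c : cfg M) : cfg M :=
  if halted c then c else
  let: (q', g, mv) := tm_delta (cf_st c) (cf_head c) in
  match mv with
  | MStay => Cfg q' (cf_left c) g (cf_right c)
  | MLeft =>
      match cf_left c with
      | [::] => Cfg q' [::] (tm_blank M) (g :: cf_right c)
      | x :: l => Cfg q' l x (g :: cf_right c)
      end
  | MRight =>
      match cf_right c with
      | [::] => Cfg q' (g :: cf_left c) (tm_blank M) [::]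
      | x :: r => Cfg q' (g :: cf_left c) x r
      end
  end.

Definition tm_init (M : TM) (w : seq bool) : cfg M :=
  match w with
  | [::] => Cfg (tm_start M) [::] (tm_blank M) [::]
  | b :: w' => Cfg (tm_start M) [::] (tm_inp M b) (map (tm_inp M) w')
  end.

Definition tm_run (M : TM) (w : seq bool) (t : nat) : cfg M :=
  iter t (@tm_step M) (tm_init M w).

Definition tm_space (M : TM) (c : cfg M) : nat :=
  size (cf_left c) + size (cf_right c) + 1.

Definition decode_sym (M : TM) (g : tm_sym M) : option bool :=
  if g == tm_inp M true then Some true
  else if g == tm_inp M false then Some false else None.

Fixpoint read_bits (M : TM) (s : seq (tm_sym M)) : seq bool :=
  match s with
  | [::] => [::]
  | g :: s' => match decode_sym g with
               | Some b => b :: read_bits s'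
               | None => [::]
               end
  end.

Definition tm_output (M : TM) (c : cfg M) : seq bool :=
  read_bits (cf_head c :: cf_right c).

Definition in_PSPACE (L : seq bool -> Prop) : Prop :=
  exists (M : TM) (a k : nat), forall w : seq bool,
    (exists t, halted (tm_run M w t)) /\
    (forall t, tm_space (tm_run M w t) <= a * (size w) ^ k + a) /\
    (L w <-> exists t, cf_st (tm_run M w t) = tm_acc M).

Definition poly_time_computable (f : seq bool -> seq bool) : Prop :=
  exists (M : TM) (a k : nat), forall w : seq bool,
    exists t, t <= a * (size w) ^ k + a /\
      cf_st (tm_run M w t) = tm_acc M /\
      tm_output (tm_run M w t) = f w.

Definition poly_reducible (L1 L2 : seq bool -> Prop) : Prop :=
  exists f, poly_time_computable f /\ forall w, L1 w <-> L2 (f w).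

Definition PSPACE_hard (L : seq bool -> Prop) : Prop :=
  forall L', in_PSPACE L' -> poly_reducible L' L.

(* Main.v *)
(** Blocks of bits of the counter hold configurations of a space-bounded machine, one bit per pair
    (tape cell, symbol).  The loop at [p1] guesses the low bits of a counter divisible by a power of
    two, and the cycle [q0 -> q1 -> q2 -> q3] turns a formula for divisibility by [d] into one for
    divisibility by [2 d], whence formulas of linear size for testing a bit.  As in Savitch's theorem,
    reachability in [2 ^ l.+1] steps is expressed by guessing a midpoint and letting the opponent
    choose one of the two halves, copied into fresh blocks so that the smaller formula occurs once.
    Blocks are treated as sets of (cell, symbol) pairs: the formula is antitone in the source block
    and monotone in the target block, so no block has to be checked to encode a configuration.

    In prefix notation the formula is a concatenation of strings indexed by tuples of positions of the
    input, whose contributions depend only on the order and the labels of these positions.  It is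
    therefore the output of a program made of nested loops over positions, and such programs run in
    polynomial time on a Turing machine that marks the loop positions on its tape. *)

From Stdlib Require Import ZArith.
From Stdlib Require List.
From Stdlib Require Import Classical_Prop.
Require Import Defs.
From mathcomp Require Import all_boot zify.

Set Implicit Arguments.
Unset Strict Implicit.
Unset Printing Implicit Defensive.

(** * Transitions of the net *)

(** The net is fixed and the counter starts at 0, so the whole instance sits in the formula, which
    has to create its own data. A guess rewrites bits just above a stretch of the counter that is
    still zero; blocks are therefore allotted from high to low, and what has been written stays in
    place. Testing bit [k] takes a formula that nests about [k] copies of one context around a fixed
    core. Numbers are thus written in unary, which is affordable because all offsets are polynomial
    in the input length. It also frees the printing program from arithmetic: an index that is a sum
    of products becomes a sequence of loops that repeat constant strings. The number of steps
    [2 ^ L] comes from counting configurations: a window of [C] cells has at most [#|csym| ^ C] of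
    them, and [C * #|csym| <= L] makes [2 ^ L] steps enough for a halting machine. *)

Definition succs (c : ocn_state) : seq ocn_state :=
  let: (q, n) := c in
  match q with
  | Lt => (Lq0, n) :: (Lf, n) :: [::]
  | Ltb => [:: (Lp1, n.+1); (Lp0, n)] ++
      if n is n'.+1 then [:: (Lq1, n); (Lq2, n); (Lq3, n); (Lf, n')] else [::]
  | Lq0 => if n is n'.+1 then [:: (Lq1, n'); (Lt, n)] else [::]
  | Lq1 => if n is n'.+1 then [:: (Lq1, n'); (Lq2, n'); (Ltb, n)] else [::]
  | Lq2 => if n is n'.+1 then [:: (Lq3, n'); (Lt, n)] else [::]
  | Lq3 => if n is n'.+1 then [:: (Lq3, n'); (Lq0, n'); (Ltb, n)] else [::]
  | Lf => if n is n'.+1 then [:: (Lg, n')] else [::]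
  | Lg => if n is n'.+1 then [:: (Lf, n')] else [::]
  | Lp0 => [:: (Ltb, n)]
  | Lp1 => if n is n'.+1 then [:: (Lp1, n.+1); (Ltb, n)] else [::]
  end.

Lemma ocn_stepE c c' : ocn_step c c' <-> List.In c' (succs c).
Proof.
case: c c' => q n [q' n']; split.
- case=> k [/= Hk [[Hn H]|[Hn H]]].
  + move: Hn Hk => -> Hk; repeat (case: H => [[<- Ek <-]|H];
      [have ->: n' = Z.to_nat k by lia|..]; rewrite -?Ek /=; auto 10).
    case: H.
  + case: n Hk Hn => // n Hk _; repeat (case: H => [[<- Ek <-]|H]; [rewrite -Ek in Hk|..]).
    all: try (case: H).
    all: rewrite /=; try (have ->: n' = n by lia); try (have ->: n' = n.+1 by lia);
      try (have ->: n' = n.+2 by lia); auto 20.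
- by case: q; case: n => [|n] /=; intros H;
    repeat match goal with
    | H : _ \/ _ |- _ => destruct H as [H|H]
    | H : False |- _ => destruct H
    end; injection H; clear H; intros; subst;
    first [ exists 0%Z; split; [cbn [fst snd]; lia|] | exists (-1)%Z; split; [cbn [fst snd]; lia|]
          | exists 1%Z; split; [cbn [fst snd]; lia|] ];
    first [ left; rewrite /delta_zero; split => //=; auto 30; fail
          | right; rewrite /delta_pos; split => //=; auto 30; fail ].
Qed.

Lemma sat_EX a c : sat (CEX a) c <-> exists c', List.In c' (succs c) /\ sat a c'.
Proof.
by split=> -[c' [/ocn_stepE H Hs]]; exists c'; split.
Qed.

(** An until formula is the least set closed under these two rules; upper bounds on what it
    satisfies are proved this way, without handling paths. *)
Lemma sat_EU_ind a b (P : ocn_state -> Prop) :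
  (forall c, sat b c -> P c) ->
  (forall c c', sat a c -> List.In c' (succs c) -> P c' -> P c) ->
  forall c, sat (CEU a b) c -> P c.
Proof.
move=> Hb Ha c [m [pi [<- [Hstep [Hm Hi]]]]].
elim: m pi Hstep Hm Hi => [|m IH] pi Hstep Hm Hi; first exact: Hb.
apply: (Ha _ (pi 1)); [exact: Hi|by apply/ocn_stepE/Hstep|].
apply: (IH (fun i => pi i.+1)) => //.
- by move=> i Hlt; exact: Hstep.
- by move=> i Hlt; exact: Hi.
Qed.

Lemma sat_EU_now a b c : sat b c -> sat (CEU a b) c.
Proof. by move=> H; exists 0, (fun _ => c). Qed.

Lemma sat_EU_next a b c c' :
  sat a c -> List.In c' (succs c) -> sat (CEU a b) c' -> sat (CEU a b) c.
Proof.
move=> Ha /ocn_stepE Hs [m [pi [H0 [Hstep [Hm Hi]]]]].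
exists m.+1, (fun i => if i is i'.+1 then pi i' else c); split => //; split.
- by case=> [|i] Hlt; [rewrite H0|exact: Hstep].
- by split=> // -[|i] Hlt //; exact: Hi.
Qed.

Lemma sat_EU_unfold a b c :
  sat (CEU a b) c ->
  sat b c \/ (sat a c /\ exists2 c', List.In c' (succs c) & sat (CEU a b) c').
Proof.
move=> H; suff: (sat (CEU a b) c /\
  (sat b c \/ (sat a c /\ exists2 c', List.In c' (succs c) & sat (CEU a b) c'))) by case.
move: c H; apply: sat_EU_ind => [c H|c c' Ha Hs [H _]].
- by split; [exact: sat_EU_now|left].
- by split; [exact: (sat_EU_next Ha Hs)|right; split => //; exists c'].
Qed.

(** * Divisibility of the counter by powers of two *)

(** A zero test: with a positive counter, [q0] always has a successor at [q1]. *)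
Definition q0_dead : ctl := CAnd (CAtom Lq0) (CNeg (CEX (CAtom Lq1))).

(* If [X] tests divisibility by [d], a path satisfying [track X] is at [q0] or [q2] exactly at the
   multiples of [d], so one turn of the cycle consumes [2 d]; it must stop at the deadlock [(q0, 0)]. *)
Definition track (X : ctl) : ctl :=
  CEX (CAnd (CNeg (CAnd (CNeg (CAtom Lt)) (CNeg (CAtom Ltb)))) X).

Definition countdown (X : ctl) : ctl := CEU (track X) q0_dead.

(** From [f] the run alternates between [f] and [g] down to 0, so parity decides where it stops. The
    guard [CNeg (CAtom Lt)] stands for truth, since only [f] and [g] are reachable from [f]. *)
Definition descent : ctl := CEU (CNeg (CAtom Lt)) (CAnd (CAtom Lf) (CNeg (CEX (CAtom Lg)))).

(** The edge from [t] to [f] keeps the counter while the one from [tb] lowers it by one, which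
    inverts the parity test at [tb]. *)
Definition even_base : ctl := CEX (CAnd (CAtom Lf) descent).

(* Divisibility by [2 ^ k.+1]: doubling requires [1 < d], so the iteration starts at [d = 2]. *)
Definition div_ctl (k : nat) : ctl := iter k (fun X => CEX (countdown X)) even_base.

(* The test at [tb] is negated because [q1] and [q3] reach [tb], while [q0] and [q2] reach [t]. *)
Definition div_spec (X : ctl) (d : nat) : Prop :=
  forall n, (sat X (Lt, n) <-> d %| n) /\ (sat X (Ltb, n) <-> ~ d %| n).

Ltac inv_succs :=
  repeat match goal with
  | H : List.In _ _ |- _ => progress cbn in H
  | H : _ \/ _ |- _ => destruct H as [H|H]
  | H : False |- _ => destruct H
  | H : (_, _) = _ |- _ => injection H; clear H; intros; subst
  | H : _ = (_, _) |- _ => injection H; clear H; intros; subst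
  end.

Lemma descent_f n : sat descent (Lf, n) <-> ~~ odd n.
Proof.
split.
- suff H c : sat descent c -> match c.1 with Lf => ~~ odd c.2 | Lg => odd c.2 | _ => True end
    by exact: (H (Lf, n)).
  move: c; apply: sat_EU_ind => [[q m]|[q m] [q' m'] _].
  + case=> /= -> H; case: m H => // m []; exists (Lg, m); split=> //.
    by apply/ocn_stepE; left.
  + by case: q => //; case: m => // m H; inv_succs => /=; rewrite ?negbK.
- suff H : forall n, (~~ odd n -> sat descent (Lf, n)) /\ (odd n -> sat descent (Lg, n))
    by case: (H n).
  elim=> {n} [|n [IHf IHg]]; split=> // Hn.
  + apply: sat_EU_now; split=> //= -[c' [/ocn_stepE H _]]; by inv_succs.
  + by apply: (@sat_EU_next _ _ _ (Lg, n)); [|left|apply: IHg; lia].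
  + by apply: (@sat_EU_next _ _ _ (Lf, n)); [|left|apply: IHf; lia].
Qed.

Lemma even_base_spec : div_spec even_base 2.
Proof.
have Hf n c : List.In c (succs n) ->
    sat (CAnd (CAtom Lf) descent) c <-> c.1 = Lf /\ ~~ odd c.2.
  by case: c => q m _; split=> -[/= ->] /descent_f.
move=> n; rewrite dvdn2; split; rewrite /even_base sat_EX; split.
- by case=> -[q m] [H /(Hf _ _ H) [/= Eq Ho]]; inv_succs.
- by move=> Ho; exists (Lf, n); split; [right; left|apply/(Hf (Lt, n)) => //; right; left].
- case=> -[q m] [H /(Hf _ _ H) [/= Eq Ho]].
  by case: n H => [|n] H; inv_succs => //; apply/negP; rewrite /= negbK.
- move/negP; rewrite negbK; case: n => // n /= Ho.
  have Hin : List.In (Lf, n) (succs (Ltb, n.+1)) by cbn; tauto.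
  by exists (Lf, n); split=> //; apply/(Hf _ _ Hin).
Qed.

(** Each of these locations sees only one of [t] and [tb], hence only one polarity of [X]. The edges
    into [t] and [tb] require a positive counter, except the one from [p0]. *)
Lemma track_iff X d c : div_spec X d ->
  sat (track X) c <->
  match c with
  | (Lq0, n) | (Lq2, n) => 0 < n /\ d %| n
  | (Lq1, n) | (Lq3, n) => 0 < n /\ ~ d %| n
  | (Lp0, n) => ~ d %| n
  | (Lp1, n) => 0 < n /\ ~ d %| n
  | _ => False
  end.
Proof.
move=> HX; rewrite /track sat_EX; case: c => q n; split.
- case=> -[q' n'] [H [/= Hq Hs]].
  have [Et|Et] : q' = Lt \/ q' = Ltb by move: Hq; case: (q') => // Hq; [left|right|case: Hq..].
  + move: Hs; rewrite Et in H *; move/(proj1 (HX n')) => Hs.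
    by case: q H; case: n => [|n] H; inv_succs.
  + move: Hs; rewrite Et in H *; move/(proj2 (HX n')) => Hs.
    by case: q H; case: n => [|n] H; inv_succs.
- have Ht m : d %| m -> sat X (Lt, m) by case: (HX m) => [[_ ?] _].
  have Hb m : ~ d %| m -> sat X (Ltb, m) by case: (HX m) => [_ [_ ?]].
  by case: q => //; case: n => [|n] H; try (case: H => // _ H);
    first [ exists (Lt, n.+1); split; [cbn; tauto | split; [move=> /= [//]|exact: Ht]]
          | exists (Ltb, n.+1); split; [cbn; tauto | split; [move=> /= [//]|exact: Hb]]
          | exists (Ltb, 0); split; [cbn; tauto | split; [move=> /= [//]|exact: Hb]] ].
Qed.

Lemma q0_dead_iff c : sat q0_dead c <-> c = (Lq0, 0).
Proof.
rewrite /q0_dead; case: c => q n; split=> [[/= -> H]|[-> ->]].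
- case: n H => // n []; exists (Lq1, n); split=> //; apply/ocn_stepE; by left.
- by split=> //= -[c' [/ocn_stepE H _]]; inv_succs.
Qed.

Lemma dvdn_mod_double d m : 0 < d -> (d %| m) = (m %% (2 * d) == 0) || (m %% (2 * d) == d).
Proof.
move=> Hd; rewrite {1}(divn_eq m (2 * d)) dvdn_addr; last by rewrite mulnCA dvdn_mull // dvdn_mull.
have : m %% (2 * d) < 2 * d by rewrite ltn_mod; lia.
move: (m %% _) => r Hr; apply/dvdnP/orP.
- by case=> -[|[|k]] Ek; [left|right|exfalso]; nia.
- by case=> /eqP ->; [exists 0|exists 1]; lia.
Qed.

Lemma modnS_eq m n : 0 < n -> m.+1 %% n = if (m %% n).+1 == n then 0 else (m %% n).+1.
Proof.
move=> Hn; rewrite -addn1 -modnDml addn1; have : m %% n < n by rewrite ltn_mod.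
move: (m %% _) => r Hr; case: eqP => [->|H]; first by rewrite modnn.
by rewrite modn_small // ltn_neqAle Hr andbT; apply/eqP.
Qed.

(** A step lowers the residue modulo [2 * d] by one, and [track X] bars [q1] and [q3] from the
    multiples of [d] and [q0] and [q2] from all other values, so each change of location is forced
    by the residue. With [1 < d] there are non-multiples for [q1] and [q3] to visit. *)
Lemma countdown_sound X d c : div_spec X d -> 1 < d -> sat (countdown X) c ->
  match c with
  | (Lq0, n) => n %% (2 * d) = 0
  | (Lq1, n) => d < n %% (2 * d)
  | (Lq2, n) => n %% (2 * d) = d
  | (Lq3, n) => 0 < n %% (2 * d) < d
  | _ => False
  end.
Proof.
move=> HX Hd; move: c; apply: sat_EU_ind => [c /q0_dead_iff ->|]; first by rewrite mod0n.
case=> q n [q' n'] /(track_iff _ HX).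
have lt_mod m : m %% (2 * d) < 2 * d by rewrite ltn_mod; lia.
have Ed m := dvdn_mod_double m (ltnW Hd).
have Hd2 : 0 < 2 * d by lia.
have Em m := modnS_eq m Hd2.
by case: q => //; case: n => [|n]; rewrite ?Ed => Hn H HP; inv_succs => //;
  rewrite ?Em in Hn HP *; move: Hn HP;
  match goal with |- context [?m %% (2 * d)] => move: (lt_mod m); move: (m %% (2 * d)) => r Hr Hn HP end;
  move: Hn HP; case: (r.+1 =P 2 * d) => E Hn HP //; lia.
Qed.

(** Induction on the counter; the four claims go together because a step of the cycle leads from one
    to the next. *)
Lemma countdown_complete X d n : div_spec X d -> 1 < d ->
  [/\ n %% (2 * d) = 0 -> sat (countdown X) (Lq0, n),
     d < n %% (2 * d) -> sat (countdown X) (Lq1, n),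
     n %% (2 * d) = d -> sat (countdown X) (Lq2, n) &
     0 < n %% (2 * d) < d -> sat (countdown X) (Lq3, n)].
Proof.
move=> HX Hd.
have lt_mod m : m %% (2 * d) < 2 * d by rewrite ltn_mod; lia.
have Ed m := dvdn_mod_double m (ltnW Hd).
have Hd2 : 0 < 2 * d by lia.
have Em m := modnS_eq m Hd2.
elim: n => [|n [IH0 IH1 IH2 IH3]].
  rewrite mod0n; split; try lia.
  by move=> _; apply: sat_EU_now; apply/q0_dead_iff.
have Tr q : match q with Lq0 | Lq2 => d %| n.+1 | Lq1 | Lq3 => ~ d %| n.+1 | _ => False end ->
    sat (track X) (q, n.+1) by move=> H; apply/(track_iff _ HX); case: q H.
move: (lt_mod n) Tr; rewrite Ed Em; move: (n %% (2 * d)) IH0 IH1 IH2 IH3 => r IH0 IH1 IH2 IH3 Hr Tr.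
case: (eqVneq r.+1 (2 * d)) Tr => Er Tr; split; try lia.
- by move=> _; apply: (@sat_EU_next _ _ _ (Lq1, n)); [exact: Tr|left|apply: IH1; lia].
- move=> Hd1; have Ht: sat (track X) (Lq1, n.+1) by apply: Tr; lia.
  case: (eqVneq r d) => E.
  + by apply: (@sat_EU_next _ _ _ (Lq2, n)); [|right; left|apply: IH2].
  + by apply: (@sat_EU_next _ _ _ (Lq1, n)); [|left|apply: IH1; lia].
- move=> E; apply: (@sat_EU_next _ _ _ (Lq3, n)); [|by left|by apply: IH3; lia].
  by apply: Tr; rewrite E eqxx orbT.
- move=> Hd1; have Ht: sat (track X) (Lq3, n.+1) by apply: Tr; lia.
  case: (eqVneq r 0) => E.
  + by apply: (@sat_EU_next _ _ _ (Lq0, n)); [|right; left|apply: IH0].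
  + by apply: (@sat_EU_next _ _ _ (Lq3, n)); [|left|apply: IH3; lia].
Qed.

(** From [t] a countdown can only start at [q0]. From [tb] it may start at [q1], [q2] or [q3], whose
    residue ranges together are exactly the nonzero residues. *)
Lemma div_spec_double X d : div_spec X d -> 1 < d -> div_spec (CEX (countdown X)) (2 * d).
Proof.
move=> HX Hd n; rewrite !sat_EX /dvdn.
have lt_mod m : m %% (2 * d) < 2 * d by rewrite ltn_mod; lia.
have [C0 C1 C2 C3] := countdown_complete n HX Hd.
split; split.
- case=> -[q m] [H] /(countdown_sound HX Hd) Hs.
  by inv_succs => //; apply/eqP.
- by move/eqP/C0 => H; exists (Lq0, n); split=> //; left.
- case=> -[q m] [H] /(countdown_sound HX Hd) Hs.
  by case: n {C0 C1 C2 C3} H => [|n] H; inv_succs => //; apply/eqP; lia.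
- move=> Hn; have Hn0 : 0 < n by case: n Hn {C0 C1 C2 C3} => //; rewrite mod0n.
  case: n Hn Hn0 C0 C1 C2 C3 => // n Hn _ C0 C1 C2 C3.
  have [E|E|E] := ltngtP (n.+1 %% (2 * d)) d.
  + by exists (Lq3, n.+1); split; [cbn; tauto|apply: C3; lia].
  + by exists (Lq1, n.+1); split; [cbn; tauto|apply: C1].
  + by exists (Lq2, n.+1); split; [cbn; tauto|apply: C2].
Qed.

Lemma div_ctl_spec k : div_spec (div_ctl k) (2 ^ k.+1).
Proof.
elim: k => [|k IH]; first exact: even_base_spec.
by rewrite expnS; apply: div_spec_double => //; rewrite -{1}(expn0 2) ltn_exp2l.
Qed.

(** * Testing a bit and guessing a block of bits *)

Definition bit (m i : nat) : bool := odd (m %/ 2 ^ i).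

(* From [tb], the countdown succeeds through [q1] or [q2] iff the remainder modulo [2 ^ k.+2] is at
   least [2 ^ k.+1].  Bit 0 is out of reach, so data is kept in the half [m] of the counter [2 m]. *)
Definition bit_ctl (k : nat) : ctl :=
  CEX (CAnd (CNeg (CAnd (CNeg (CAtom Lq1)) (CNeg (CAtom Lq2)))) (countdown (div_ctl k))).

Lemma bit_ctl_spec k m : sat (bit_ctl k) (Ltb, 2 * m) <-> bit m k.
Proof.
have Hd : 1 < 2 ^ k.+1 by rewrite -{1}(expn0 2) ltn_exp2l.
have HX := div_ctl_spec k.
(* Doubling shifts bit [k] of [m] to bit [k.+1] of the counter, the top bit of the residue modulo
   [2 ^ k.+2]. *)
have -> : bit m k = (2 ^ k.+1 <= (2 * m) %% (2 * 2 ^ k.+1)).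
  rewrite -muln_modr [X in X <= _]expnS leq_mul2l /= /bit.
  have Hm := divn_eq m (2 ^ k.+1); have Hlt : m %% 2 ^ k.+1 < 2 ^ k.+1 by rewrite ltn_mod expn_gt0.
  move: (m %/ 2 ^ k.+1) (m %% 2 ^ k.+1) Hm Hlt => a r -> Hlt.
  rewrite expnS mulnA divnMDl ?expn_gt0 // oddD oddM /= andbF /=.
  case: leqP => Hr; last by rewrite divn_small.
  have -> : r = 1 * 2 ^ k + (r - 2 ^ k) by lia.
  rewrite divnMDl ?expn_gt0 // divn_small ?addn0 //; rewrite expnS in Hlt; lia.
have [C0 C1 C2 C3] := countdown_complete (2 * m) HX Hd.
rewrite sat_EX; split.
- case=> -[q n] [H [/= Hq /(countdown_sound HX Hd)]].
  have [Eq|Eq] : q = Lq1 \/ q = Lq2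
    by move: Hq; case: (q) => // Hq; first [by left|by right|by case: Hq].
  + case: (2 * m) H => [|n'] H; rewrite Eq in H * => HP; inv_succs => //; exact: ltnW.
  + case: (2 * m) H => [|n'] H; rewrite Eq in H * => HP; inv_succs => //; by rewrite HP.
- move: C0 C1 C2 C3; case: (2 * m) => [|n] _ C1 C2 _; first by rewrite mod0n leqNgt expn_gt0.
  rewrite leq_eqVlt => /orP [/eqP H|H].
  + by exists (Lq2, n.+1); split; [cbn; tauto|split; [case|apply: C2]].
  + by exists (Lq1, n.+1); split; [cbn; tauto|split; [case|apply: C1]].
Qed.

(* The path may leave [tb] only through [p0] (adding 0) or through the loop at [p1], which it must
   leave before the next multiple of [2 ^ hi.+1], at a multiple of [2 ^ lo.+1]. *)
Definition ex_ctl (hi lo : nat) (psi : ctl) : ctl :=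
  CEX (CEU (CNeg (CAnd (CNeg (CAtom Lp0)) (CNeg (CEX (CAnd (CAtom Ltb) (div_ctl hi))))))
           (CAnd (CAtom Ltb) (CAnd (CNeg (div_ctl lo)) psi))).

(** The start is a multiple of [2 ^ hi.+1] and the path stays below the next one, so what it adds is
    a multiple of [2 ^ lo.+1] less than [2 ^ hi.+1]; halved, this is [v * 2 ^ lo]. *)
Lemma ex_ctl_spec hi lo m psi : lo <= hi -> 2 ^ hi %| m ->
  sat (ex_ctl hi lo psi) (Ltb, 2 * m) <->
  exists v, v < 2 ^ (hi - lo) /\ sat psi (Ltb, 2 * (m + v * 2 ^ lo)).
Proof.
move=> Hlo Hhi; have Fhi := div_ctl_spec hi; have Flo := div_ctl_spec lo.
rewrite /ex_ctl sat_EX; set A := CNeg _; set G := CAnd _ _.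
have HG c : sat G c <-> exists n, [/\ c = (Ltb, n), 2 ^ lo.+1 %| n & sat psi c].
  case: c => q n; split.
  - case=> /= -> [H1 H2]; exists n; split=> //.
    by case: (boolP (2 ^ lo.+1 %| n)) => // /negP /(proj2 (Flo n)).
  - by case=> n' [[-> ->] H1 H2]; split=> //; split=> //; move/(proj2 (Flo n')).
have HE c : sat (CEX (CAnd (CAtom Ltb) (div_ctl hi))) c <->
    exists n, List.In (Ltb, n) (succs c) /\ ~ 2 ^ hi.+1 %| n.
  rewrite sat_EX; split.
  - by case=> -[q n] [H [/= Hq Hs]]; rewrite Hq in H Hs; exists n; split=> //; apply/(proj2 (Fhi n)).
  - by case=> n [H Hn]; exists (Ltb, n); split=> //; split=> //; apply/(proj2 (Fhi n)).
have HA c : sat A c -> match c with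
    | (Lp0, _) => True | (Lp1, n) | (Lq1, n) | (Lq3, n) => 0 < n /\ ~ 2 ^ hi.+1 %| n
    | _ => False end.
  case: c => q n Hs.
  (* The guard is a negated conjunction and yields only a double negation, which this case
     distinction removes. *)
  have Hdec : (0 < n /\ ~ 2 ^ hi.+1 %| n) \/ ~ (0 < n /\ ~ 2 ^ hi.+1 %| n).
    case: (posnP n) => Hn; first by right; rewrite Hn => -[].
    by case: (boolP (2 ^ hi.+1 %| n)) => Hd; [right => -[_]; apply|left; split=> //; apply/negP].
  have Hq : q <> Lp0 -> ~ ~ exists n', List.In (Ltb, n') (succs (q, n)) /\ ~ 2 ^ hi.+1 %| n'.
    by move=> Hq HN; apply: Hs; split => // /HE.
  case: q {Hs} Hq => // /(_ ltac:(discriminate)) Hq;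
   first [ by case: Hq => -[n' [H _]]; case: n H {Hdec} => [|n] H; inv_succs
   | case: Hdec => // Hdec; case: Hq => -[n' [H Hn]]; apply: Hdec; by case: n H => [|n] H; inv_succs ].
have dvd2 j : (2 ^ j.+1 %| 2 * m) = (2 ^ j %| m) by rewrite expnS dvdn_pmul2l.
have Hlom : 2 ^ lo %| m by apply: dvdn_trans Hhi; rewrite dvdn_Pexp2l.
split.
- case=> c [Hc HU].
  have P1 c' : sat (CEU A G) c' -> match c' with
      | (Lp1, n) => exists j, [/\ n <= j, forall i, n <= i <= j -> ~ 2 ^ hi.+1 %| i,
                                2 ^ lo.+1 %| j & sat psi (Ltb, j)]
      | (Lp0, n) | (Ltb, n) => 2 ^ lo.+1 %| n /\ sat psi (Ltb, n)
      | _ => True end.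
    move: c' {c Hc HU}; apply: sat_EU_ind => [c /HG [n [-> H1 H2]] //|].
    case=> q n [q' n'] /HA; case: q => //.
    + by move=> _ H HP; inv_succs.
    + case: n => [|n] [Hn0 Hn] H HP //; inv_succs.
      * case: HP => j [Hj1 Hj2 Hj3 Hj4]; exists j; split=> //; first by lia.
        move=> i Hi; have [->//|Hne] := eqVneq i n.+1; apply: Hj2; lia.
      * by case: HP => H1 H2; exists n.+1; split=> // i Hi; have -> : i = n.+1 by [lia].
  have {P1} := P1 _ HU.
  (* A path leaving [tb] through [q1] or [q3] still has the counter [2 * m], a multiple of
     [2 ^ hi.+1], at which the guard fails there; [q2] and [f] never satisfy it. *)
  have HNA q n : match q with Lq1 | Lq3 => n = 2 * m | Lp0 | Lp1 | Ltb => False | _ => True end ->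
      ~ sat (CEU A G) (q, n).
    move=> Hq /sat_EU_unfold [/HG [n' [[E]]]|[/HA H _]]; first by rewrite E in Hq.
    by case: q Hq H => // -> [_ []]; rewrite dvd2.
  have Hend j : 2 * m <= j -> (forall i, 2 * m < i <= j -> ~ 2 ^ hi.+1 %| i) ->
      2 ^ lo.+1 %| j -> sat psi (Ltb, j) ->
      exists v, v < 2 ^ (hi - lo) /\ sat psi (Ltb, 2 * (m + v * 2 ^ lo)).
    move=> Hj1 Hj2 Hj3 Hj4.
    have /dvdnP [v Hv] : 2 ^ lo.+1 %| j - 2 * m by rewrite dvdn_subl // dvd2.
    exists v; have -> : 2 * (m + v * 2 ^ lo) = j by move: Hv; rewrite expnS; nia.
    split=> //; rewrite ltnNge; apply/negP => Hge.
    have E : 2 ^ hi.+1 = 2 ^ (hi - lo) * 2 ^ lo.+1 by rewrite -expnD addnS subnK.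
    apply: (Hj2 (2 * m + 2 ^ hi.+1)); last by rewrite dvdn_addl ?dvdnn // dvd2.
    have : 0 < 2 ^ hi.+1 by rewrite expn_gt0.
    have : 2 ^ hi.+1 <= v * 2 ^ lo.+1 by rewrite E leq_mul2r Hge orbT.
    by lia.
  case: c Hc HU => q n Hc HU HP.
  have [[Eq En]|[Eq En]] : q = Lp1 /\ n = (2 * m).+1 \/ q = Lp0 /\ n = 2 * m.
    move: HNA Hc; case: (2 * m) => [|n0] HNA Hc; inv_succs; auto; by case: (HNA _ _ _ HU).
  + move: HP; rewrite Eq En => -[j [Hj1 Hj2 Hj3 Hj4]].
    apply: (Hend j _ _ Hj3 Hj4); [lia|move=> i Hi; apply: Hj2; lia].
  + by move: HP; rewrite Eq En => -[H1 H2]; apply: (Hend (2 * m)) => //; lia.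
- case=> v [Hv Hs]; set j := 2 * (m + v * 2 ^ lo) in Hs.
  have HGj : sat G (Ltb, j).
    by apply/HG; exists j; split=> //; rewrite /j expnS dvdn_pmul2l // dvdn_addr // dvdn_mull.
  have Hjm : j < 2 * m + 2 ^ hi.+1.
    have -> : 2 ^ hi.+1 = 2 * (2 ^ (hi - lo) * 2 ^ lo) by rewrite -expnD subnK // expnS.
    by rewrite /j mulnDr ltn_add2l ltn_mul2l /= ltn_mul2r expn_gt0.
  have Ap0 n : sat A (Lp0, n) by case=> H _; exact: H.
  have Ap1 n : 0 < n -> ~ 2 ^ hi.+1 %| n -> sat A (Lp1, n).
    move=> Hn Hd [_ H]; apply: H; apply/HE; exists n; split=> //.
    by case: n Hn {Hd} => // n _; right; left.
  (* The way through [p1] adds at least one, so [v = 0] has to go through [p0]. *)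
  case: (posnP v) => Hv0.
    have Ej : j = 2 * m by rewrite /j Hv0 mul0n addn0.
    exists (Lp0, 2 * m); split; first by case: (2 * m) => [|?]; right; left.
    apply: (@sat_EU_next _ _ _ (Ltb, 2 * m)); [exact: Ap0|by left|].
    by apply: sat_EU_now; rewrite -Ej.
  have Hj : 2 * m < j by rewrite /j mulnDr -{1}(addn0 (2 * m)) ltn_add2l !muln_gt0 Hv0 expn_gt0.
  have Hnd i : 2 * m < i <= j -> ~ 2 ^ hi.+1 %| i.
    move=> /andP [Hi1 Hi2] Hi.
    have : 2 ^ hi.+1 %| i - 2 * m by rewrite dvdn_subl // ?dvd2 //; lia.
    by move/dvdn_leq => /(_ ltac:(lia)); lia.
  (* Built backwards from the exit at [j]: [k] counts the increments still to be made at [p1]. *)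
  suff Hd k : k < j - 2 * m -> sat (CEU A G) (Lp1, j - k).
    exists (Lp1, (2 * m).+1); split; first by case: (2 * m) => [|?]; left.
    have -> : (2 * m).+1 = j - (j - (2 * m).+1) by lia.
    by apply: Hd; lia.
  elim: k => [|k IH] Hk.
    rewrite subn0; apply: (@sat_EU_next _ _ _ (Ltb, j)); [| |exact: sat_EU_now].
      by apply: Ap1; [lia|apply: Hnd; lia].
    by case: (j) Hj => // ? _; right; left.
  apply: (@sat_EU_next _ _ _ (Lp1, j - k)); [apply: Ap1; [lia|apply: Hnd; lia]| |by apply: IH; lia].
  have -> : j - k = (j - k.+1).+1 by lia.
  by have : 0 < j - k.+1 by [lia]; case: (j - k.+1) => // ? _; left.
Qed.

(** * Bounded reachability in a cellular automaton *)

Lemma bit_add_high m v hi lo j : lo <= hi -> 2 ^ hi %| m -> v < 2 ^ (hi - lo) -> hi <= j ->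
  bit (m + v * 2 ^ lo) j = bit m j.
Proof.
move=> Hlo /dvdnP [a ->] Hv Hj; rewrite /bit -(subnKC Hj) expnD !divnMA.
have Hlt : v * 2 ^ lo < 2 ^ hi by rewrite -{1}(subnK Hlo) expnD ltn_mul2r expn_gt0.
by rewrite mulnK ?expn_gt0 // divnMDl ?expn_gt0 // (divn_small Hlt) addn0.
Qed.

Lemma bit_add_low m v hi lo i : lo <= hi -> 2 ^ hi %| m -> i < hi - lo ->
  bit (m + v * 2 ^ lo) (lo + i) = bit v i.
Proof.
move=> Hlo /dvdnP [a ->] Hi; rewrite /bit.
have -> : hi = (hi - lo - i).-1.+1 + (lo + i) by lia.
rewrite expnD [in X in a * (X * _)]expnS expnD.
rewrite (_ : a * _ + _ = (a * 2 ^ (hi - lo - i).-1 * 2 * 2 ^ i + v) * 2 ^ lo); last by rewrite !mulnA; nia.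
rewrite divnMA mulnK ?expn_gt0 // divnMDl ?expn_gt0 //.
by rewrite oddD !oddM andbF.
Qed.

Lemma bits_exist (P : nat -> bool) w : exists2 v, v < 2 ^ w & forall i, i < w -> bit v i = P i.
Proof.
elim: w => [|w [v Hv IH]]; first by exists 0.
exists (v + P w * 2 ^ w) => [|i Hi].
  by rewrite expnS mul2n -addnn; case: (P w); lia.
have [Hlt|->] : i < w \/ i = w by lia.
  rewrite -(IH i Hlt) /bit (_ : 2 ^ w = 2 ^ (w - i) * 2 ^ i); last by rewrite -expnD subnK // ltnW.
  by rewrite mulnA addnC divnMDl ?expn_gt0 // oddD oddM oddX subn_eq0 leqNgt Hlt andbF.
by rewrite /bit addnC divnMDl ?expn_gt0 // divn_small // addn0; case: (P w).
Qed.

(** The state of the counter after a guess of the bits from [lo] up to [hi]; divisibility by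
    [2 ^ lo] is what a following guess, with [lo] as its upper end, requires. *)
Definition ext (hi lo m m' : nat) : Prop :=
  2 ^ lo %| m' /\ forall j, hi <= j -> bit m' j = bit m j.

Lemma ex_elim hi lo m psi : lo <= hi -> 2 ^ hi %| m -> sat (ex_ctl hi lo psi) (Ltb, 2 * m) ->
  exists2 m', ext hi lo m m' & sat psi (Ltb, 2 * m').
Proof.
move=> Hlo Hm /(ex_ctl_spec _ Hlo Hm) [v [Hv Hs]]; exists (m + v * 2 ^ lo) => //; split.
- rewrite dvdn_addr ?dvdn_mull //; apply: dvdn_trans Hm; by rewrite dvdn_Pexp2l.
- by move=> j Hj; rewrite (bit_add_high Hlo Hm).
Qed.

(** The new block may receive any pattern [P]. Quantifying over [m'] instead of the added number
    hides the arithmetic: later arguments see only bits. *)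
Lemma ex_intro hi lo m psi (P : nat -> bool) : lo <= hi -> 2 ^ hi %| m ->
  (forall m', ext hi lo m m' -> (forall i, i < hi - lo -> bit m' (lo + i) = P i) ->
     sat psi (Ltb, 2 * m')) ->
  sat (ex_ctl hi lo psi) (Ltb, 2 * m).
Proof.
move=> Hlo Hm H; have [v Hv HP] := bits_exist P (hi - lo).
apply/(ex_ctl_spec _ Hlo Hm); exists v; split=> //; apply: H.
- split; first by rewrite dvdn_addr ?dvdn_mull //; apply: dvdn_trans Hm; rewrite dvdn_Pexp2l.
  by move=> j Hj; rewrite (bit_add_high Hlo Hm).
- by move=> i Hi; rewrite (bit_add_low _ Hlo Hm) // HP.
Qed.

Lemma sat_and a b c : sat (CAnd a b) c -> sat a c /\ sat b c.
Proof. by []. Qed.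

Lemma sat_neg a c : sat (CNeg a) c -> ~ sat a c.
Proof. by []. Qed.

(** The atom [tb] serves as truth, since these conjunctions are evaluated at [tb]. *)
Definition conj_ctl (l : seq ctl) : ctl := foldr CAnd (CAtom Ltb) l.
Definition imp_ctl (a b : ctl) : ctl := CNeg (CAnd a (CNeg b)).

Lemma conj_cat l1 l2 n : sat (conj_ctl (l1 ++ l2)) (Ltb, n) <->
  sat (conj_ctl l1) (Ltb, n) /\ sat (conj_ctl l2) (Ltb, n).
Proof.
elim: l1 => [|a l1 IH]; first by split=> [|[]].
by rewrite /= -/(conj_ctl _) IH; tauto.
Qed.

Lemma conj_flatten (T : eqType) (F : T -> seq ctl) (l : seq T) n :
  sat (conj_ctl (flatten (map F l))) (Ltb, n) <->
  forall i, i \in l -> sat (conj_ctl (F i)) (Ltb, n).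
Proof.
elim: l => [|i0 l IH] //=; rewrite conj_cat IH; split=> [[H0 H] i|H].
- by rewrite inE => /predU1P [->|] //; exact: H.
- by split=> [|i Hi]; apply: H; rewrite inE ?eqxx ?Hi ?orbT.
Qed.

Lemma conj_map (T : eqType) (F : T -> ctl) (l : seq T) n :
  sat (conj_ctl (map F l)) (Ltb, n) <-> forall i, i \in l -> sat (F i) (Ltb, n).
Proof.
rewrite -[map F l]flatten_map1 conj_flatten.
by split=> H i Hi; have := H i Hi => /=; [case|].
Qed.

Lemma imp_bit m i j : sat (imp_ctl (bit_ctl i) (bit_ctl j)) (Ltb, 2 * m) <-> (bit m i -> bit m j).
Proof.
rewrite /imp_ctl; split=> [H Hi|H [/bit_ctl_spec Hi]].
- by apply/negPn/negP => Hj; apply: H; split; [apply/bit_ctl_spec|move/bit_ctl_spec; exact/negP].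
- by apply; apply/bit_ctl_spec/H.
Qed.

(** * Reachability formulas for a cellular automaton and their correctness *)

Section Savitch.
Variables (sg C bl : nat) (delta : nat -> nat -> nat -> nat).
Hypotheses (bl_lt : bl < sg) (delta_lt : forall a b d, delta a b d < sg).

(** Both border cells are pinned to [bl], so every cell between them has its two neighbours inside
    the row. *)
Definition ca (f : nat -> nat) (c : nat) : nat :=
  if (c == 0) || (c == C.-1) then bl else delta (f c.-1) (f c) (f c.+1).

Let W := C * sg.

Definition cell_ctl (off c s : nat) : ctl := bit_ctl (off * W + (c * sg + s)).
Definition cell (m off c s : nat) : bool := bit m (off * W + (c * sg + s)).

Definition incl_ctl (a b a' b' : nat) : ctl :=
  conj_ctl (flatten [seq flatten [seq [:: imp_ctl (cell_ctl a c s) (cell_ctl b c s);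
                                          imp_ctl (cell_ctl a' c s) (cell_ctl b' c s)]
                                 | s <- iota 0 sg] | c <- iota 0 C]).

(* Symbol [sg + d] of cell [c] is symbol [d] of cell [c.+1]. *)
Definition rule_ctl (c a b d : nat) : ctl :=
  CNeg (CAnd (cell_ctl 1 c.-1 a) (CAnd (cell_ctl 1 c b) (CAnd (cell_ctl 1 c (sg + d))
       (CNeg (cell_ctl 0 c (delta a b d)))))).

Definition step_items (c : nat) : seq ctl :=
  if (c == 0) || (c == C.-1) then [:: cell_ctl 0 c bl]
  else flatten [seq flatten [seq [seq rule_ctl c a b d | d <- iota 0 sg] | b <- iota 0 sg]
               | a <- iota 0 sg].

Definition step_ctl : ctl := conj_ctl (flatten (map step_items (iota 0 C))).

(* Blocks of level l, in units of W bits above offset 3 l W: the new pair of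
   configurations occupies blocks 1 and 0, the midpoint block 2, the old pair blocks 4 and 3. *)
Definition halves_ctl (l : nat) (X : ctl) : ctl :=
  CAnd (CNeg (CAnd (CNeg (incl_ctl (3 * l + 1) (3 * l + 4) (3 * l + 2) (3 * l + 0)))
                   (CNeg (incl_ctl (3 * l + 1) (3 * l + 2) (3 * l + 3) (3 * l + 0)))))
       (CNeg X).

(** Read: some midpoint is such that for every new pair, if its source lies in the old source and
    its target contains the midpoint, or its source lies in the midpoint and its target contains the
    old target, then [X] holds. The negations around the inner guesses make them universal. *)
Definition level_ctl (l : nat) (X : ctl) : ctl :=
  ex_ctl ((3 * l + 3) * W) ((3 * l + 2) * W)
    (CNeg (ex_ctl ((3 * l + 2) * W) ((3 * l + 1) * W)
      (ex_ctl ((3 * l + 1) * W) ((3 * l + 0) * W) (halves_ctl l X)))).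

Fixpoint reach_ctl (l : nat) : ctl :=
  if l is l'.+1 then level_ctl l' (reach_ctl l') else step_ctl.

Definition init_ctl (L : nat) (init : nat -> nat) : ctl :=
  conj_ctl [seq cell_ctl (3 * L + 1) c (init c) | c <- iota 0 C].

Definition final_ctl (L : nat) (bad : nat -> bool) : ctl :=
  conj_ctl (flatten [seq [seq CNeg (cell_ctl (3 * L + 0) c s) | s <- iota 0 sg & bad s]
                    | c <- iota 0 C]).

Definition accept_ctl (L : nat) (init : nat -> nat) (bad : nat -> bool) : ctl :=
  ex_ctl ((3 * L + 2) * W) ((3 * L + 1) * W)
    (CAnd (init_ctl L init)
      (ex_ctl ((3 * L + 1) * W) ((3 * L + 0) * W) (CAnd (final_ctl L bad) (reach_ctl L)))).

Lemma incl_spec m a b a' b' : sat (incl_ctl a b a' b') (Ltb, 2 * m) <->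
  forall c s, c < C -> s < sg -> (cell m a c s -> cell m b c s) /\ (cell m a' c s -> cell m b' c s).
Proof.
rewrite /incl_ctl conj_flatten; split.
- move=> H c s Hc Hs; have := H c; rewrite mem_iota conj_flatten => /(_ Hc s).
  by rewrite mem_iota => /(_ Hs) [/imp_bit H1 [/imp_bit H2 _]].
- move=> H c; rewrite mem_iota conj_flatten => Hc s; rewrite mem_iota => Hs.
  by have [H1 H2] := H c s Hc Hs; split; [apply/imp_bit|split; [apply/imp_bit|]].
Qed.

Lemma rule_spec m c a b d : sat (rule_ctl c a b d) (Ltb, 2 * m) <->
  (cell m 1 c.-1 a -> cell m 1 c b -> cell m 1 c.+1 d -> cell m 0 c (delta a b d)).
Proof.
have E : cell m 1 c.+1 d = bit m (1 * W + (c * sg + (sg + d))).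
  by rewrite /cell; congr bit; rewrite mulSn; lia.
rewrite E; split.
- move=> H H1 H2 H3; apply/negPn/negP => H4; apply: H.
  split; [exact/bit_ctl_spec|split; [exact/bit_ctl_spec|split; [exact/bit_ctl_spec|]]].
  by move/bit_ctl_spec; exact/negP.
- move=> H [/bit_ctl_spec H1 [/bit_ctl_spec H2 [/bit_ctl_spec H3 H4]]].
  by apply: H4; apply/bit_ctl_spec/H.
Qed.

Lemma step_spec m : sat step_ctl (Ltb, 2 * m) <->
  forall c, c < C -> if (c == 0) || (c == C.-1) then is_true (cell m 0 c bl) else
    forall a b d, a < sg -> b < sg -> d < sg ->
      cell m 1 c.-1 a -> cell m 1 c b -> cell m 1 c.+1 d -> cell m 0 c (delta a b d).
Proof.
rewrite /step_ctl conj_flatten; split=> H c.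
- move=> Hc; have := H c; rewrite mem_iota /step_items => /(_ Hc).
  case: ifP => _; first by case=> /bit_ctl_spec.
  rewrite conj_flatten => {}H a b d Ha Hb Hd; apply/rule_spec.
  have := H a; rewrite mem_iota conj_flatten => /(_ Ha b); rewrite mem_iota => /(_ Hb).
  by rewrite conj_map => /(_ d); rewrite mem_iota; apply.
- rewrite mem_iota => /H; rewrite /step_items; case: ifP => _ Hc.
  + by split=> //; apply/bit_ctl_spec.
  + rewrite conj_flatten => a; rewrite mem_iota conj_flatten => Ha b; rewrite mem_iota conj_map => Hb d.
    by rewrite mem_iota => Hd; apply/rule_spec/Hc.
Qed.

Lemma ca_lt f : (forall c, f c < sg) -> forall c, ca f c < sg.
Proof. by move=> _ c; rewrite /ca; case: ifP. Qed.

Lemma iter_ca_lt f n : (forall c, f c < sg) -> forall c, iter n ca f c < sg.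
Proof. by move=> Hf; elim: n => //= n IH; exact: ca_lt. Qed.

Lemma cell_idx_lt c s : c < C -> s < sg -> c * sg + s < W.
Proof.
move=> Hc Hs; apply: (@leq_trans (c.+1 * sg)); first by rewrite mulSn addnC ltn_add2r.
by rewrite leq_mul2r Hc orbT.
Qed.

Lemma ext_cell hi lo m m' off c s : ext hi lo m m' -> hi <= off * W -> cell m' off c s = cell m off c s.
Proof. by case=> _ H Hle; rewrite /cell H // (leq_trans Hle) // leq_addr. Qed.

Lemma block_leq l a b : a <= b -> (3 * l + a) * W <= (3 * l + b) * W.
Proof. by move=> H; rewrite leq_mul2r leq_add2l H orbT. Qed.

(** It suffices that the source contains the configuration [f]; further pairs in it only add demands
    on the target. The universal pair is instantiated by exact copies of the two ends of each
    half. *)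
Lemma reach_sound l m f : 2 ^ ((3 * l + 0) * W) %| m -> (forall c, f c < sg) ->
  sat (reach_ctl l) (Ltb, 2 * m) ->
  (forall c, c < C -> cell m (3 * l + 1) c (f c)) ->
  forall c, c < C -> cell m (3 * l + 0) c (iter (2 ^ l) ca f c).
Proof.
elim: l m f => [|l IH] m f Hm Hf.
  rewrite muln0 !add0n => /step_spec H Hx c Hc.
  have := H c Hc; rewrite /= /ca; case: ifP => // Hb; apply=> //; apply: Hx => //; lia.
move=> Hs Hx; have Hm' : 2 ^ ((3 * l + 3) * W) %| m by rewrite mulnS addn0 addnC in Hm.
have leW a b : a <= b -> a * W <= b * W by move=> H; rewrite leq_mul2r H orbT.
have [m1 E1 /sat_neg Hs1] := ex_elim (block_leq l (isT : 2 <= 3)) Hm' Hs.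
(* One half of the path, from block [p] to block [q]: if the image were missing from [q], copies of
   [p] and [q] in the new blocks would satisfy the formula refuted by [Hs1]. *)
have Inst (p q : nat) f' : (forall c, f' c < sg) -> 3 * l + 2 <= p -> 3 * l + 2 <= q ->
    (p = 3 * l + 4 /\ q = 3 * l + 2 \/ p = 3 * l + 2 /\ q = 3 * l + 3) ->
    (forall c, c < C -> cell m1 p c (f' c)) ->
    forall c, c < C -> cell m1 q c (iter (2 ^ l) ca f' c).
  move=> Hf' Hp Hq Hpq Hcells c Hc; apply/negPn/negP => Hneg; apply: Hs1.
  apply: (ex_intro (P := fun i => bit m1 (p * W + i)) (block_leq l (isT : 1 <= 2)) E1.1) => m2 E2 B2.
  apply: (ex_intro (P := fun i => bit m1 (q * W + i)) (block_leq l (isT : 0 <= 1)) E2.1) => m3 E3 B3.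
  have K1 c0 s : c0 < C -> s < sg -> cell m3 (3 * l + 1) c0 s = cell m1 p c0 s.
    move=> Hc0 Hs0; rewrite (ext_cell _ _ E3) //.
    by rewrite /cell B2 // -mulnBl; have -> : 3 * l + 2 - (3 * l + 1) = 1 by [lia]; rewrite mul1n cell_idx_lt.
  have K0 c0 s : c0 < C -> s < sg -> cell m3 (3 * l + 0) c0 s = cell m1 q c0 s.
    move=> Hc0 Hs0.
    by rewrite /cell B3 // -mulnBl; have -> : 3 * l + 1 - (3 * l + 0) = 1 by [lia]; rewrite mul1n cell_idx_lt.
  have Khi r c0 s : 3 * l + 2 <= r -> cell m3 r c0 s = cell m1 r c0 s.
    by move=> Hr; rewrite (ext_cell _ _ E3) ?(ext_cell _ _ E2) //; apply: leW; lia.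
  split.
  - case=> H1 H2; case: Hpq => -[Ep Eq].
    + by apply: H1; apply/incl_spec => c0 s Hc0 Hs0; rewrite K1 // K0 // !Khi ?Ep ?Eq //; lia.
    + by apply: H2; apply/incl_spec => c0 s Hc0 Hs0; rewrite K1 // K0 // !Khi ?Ep ?Eq //; lia.
  - move=> Hr; move/negP: Hneg; apply.
    rewrite -K0 ?iter_ca_lt //; apply: IH => //; first by case: E3.
    by move=> c0 Hc0; rewrite K1 // Hcells.
have leE c s : cell m (3 * l.+1 + 1) c s = cell m1 (3 * l + 4) c s.
  have -> : 3 * l.+1 + 1 = 3 * l + 4 by [lia]; rewrite (ext_cell _ _ E1) //; apply: leW; lia.
have leE' c s : cell m (3 * l.+1 + 0) c s = cell m1 (3 * l + 3) c s.
  have -> : 3 * l.+1 + 0 = 3 * l + 3 by [lia]; rewrite (ext_cell _ _ E1) //; apply: leW; lia.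
move=> c Hc; rewrite leE' expnS mul2n -addnn iterD.
apply: (Inst (3 * l + 2)) => //; try lia; first exact: iter_ca_lt.
apply: (Inst (3 * l + 4)) => //; try lia.
by move=> c0 Hc0; rewrite -leE Hx.
Qed.

(** Here the source is contained in [f], so every rule that fires is one of [f] itself. Containment
    passes on to any new source the opponent picks, and the midpoint is written exactly. *)
Lemma reach_complete l m f : 2 ^ ((3 * l + 0) * W) %| m -> (forall c, f c < sg) ->
  (forall c s, c < C -> s < sg -> cell m (3 * l + 1) c s -> s = f c) ->
  (forall c, c < C -> cell m (3 * l + 0) c (iter (2 ^ l) ca f c)) ->
  sat (reach_ctl l) (Ltb, 2 * m).
Proof.
elim: l m f => [|l IH] m f Hm Hf Hx Hy.
  apply/step_spec => c Hc; have := Hy c Hc; rewrite /= /ca; case: ifP => // Hb H a b d Ha Hb' Hd.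
  have Hx' c0 s : c0 < C -> s < sg -> cell m 1 c0 s -> s = f c0 by move=> *; apply: Hx.
  move=> /Hx' -> //; last by lia.
  move=> /Hx' -> //; move=> /Hx' -> //; lia.
have Hm' : 2 ^ ((3 * l + 3) * W) %| m by rewrite mulnS addn0 addnC in Hm.
have leW a b : a <= b -> a * W <= b * W by move=> H; rewrite leq_mul2r H orbT.
have sg_gt0 : 0 < sg by apply: leq_trans bl_lt.
(* One-hot encoding of the midpoint: bit [c * sg + s] is set iff [s] is the symbol of cell [c]. *)
apply: (ex_intro (P := fun i => i %% sg == iter (2 ^ l) ca f (i %/ sg))
  (block_leq l (isT : 2 <= 3)) Hm') => m1 E1 B1.
have Z c s : c < C -> s < sg -> cell m1 (3 * l + 2) c s = (s == iter (2 ^ l) ca f c).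
  move=> Hc Hs; rewrite /cell B1; last first.
    by rewrite -mulnBl; have -> : 3 * l + 3 - (3 * l + 2) = 1 by [lia]; rewrite mul1n cell_idx_lt.
  by rewrite modnMDl modn_small // divnMDl // divn_small // addn0.
move=> /(ex_elim (block_leq l (isT : 1 <= 2)) E1.1) [m2 E2].
move=> /(ex_elim (block_leq l (isT : 0 <= 1)) E2.1) [m3 E3] [HD]; apply.
have Khi r c0 s : 3 * l + 2 <= r -> cell m3 r c0 s = cell m1 r c0 s.
  by move=> Hr; rewrite (ext_cell _ _ E3) ?(ext_cell _ _ E2) //; apply: leW; lia.
have leE c s : cell m (3 * l.+1 + 1) c s = cell m1 (3 * l + 4) c s.
  have -> : 3 * l.+1 + 1 = 3 * l + 4 by [lia]; rewrite (ext_cell _ _ E1) //; apply: leW; lia.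
have leE' c s : cell m (3 * l.+1 + 0) c s = cell m1 (3 * l + 3) c s.
  have -> : 3 * l.+1 + 0 = 3 * l + 3 by [lia]; rewrite (ext_cell _ _ E1) //; apply: leW; lia.
have IHs f' : (forall c, f' c < sg) ->
      (forall c s, c < C -> s < sg -> cell m3 (3 * l + 1) c s -> s = f' c) ->
    (forall c, c < C -> cell m3 (3 * l + 0) c (iter (2 ^ l) ca f' c)) -> sat (reach_ctl l) (Ltb, 2 * m3).
  by apply: IH; case: E3.
(* That one of the two halves was chosen is known only under a double negation, so the goal is
   decided classically in order to argue by contradiction. *)
case: (classic (sat (reach_ctl l) (Ltb, 2 * m3))) => // Hn; case: HD; split=> /incl_spec H; apply: Hn.
- apply: (IHs f) => // [c s Hc Hs /(H c s Hc Hs).1|c Hc].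
  + by rewrite Khi -?leE; [exact: Hx|lia].
  + by apply: (H c _ Hc (iter_ca_lt _ Hf _)).2; rewrite Khi // Z ?iter_ca_lt.
- apply: (IHs (iter (2 ^ l) ca f)) => [|c s Hc Hs /(H c s Hc Hs).1|c Hc].
  + exact: iter_ca_lt.
  + by rewrite Khi // Z // => /eqP.
  + rewrite -iterD addnn -mul2n -expnS.
    by apply: (H c _ Hc (iter_ca_lt _ Hf _)).2; rewrite Khi -?leE' ?Hy //; lia.
Qed.

(** The initial block need only contain [init] and the final block need only avoid bad symbols: by
    [reach_sound] the latter contains the true result, whatever else was guessed. *)
Lemma accept_spec L init bad : (forall c, init c < sg) ->
  sat (accept_ctl L init bad) (Ltb, 0) <-> forall c, c < C -> ~~ bad (iter (2 ^ L) ca init c).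
Proof.
move=> Hi.
have sg_gt0 : 0 < sg by apply: leq_trans bl_lt.
rewrite -(muln0 2); split.
- move=> /(ex_elim (block_leq L (isT : 1 <= 2)) (dvdn0 _)) [m1 E1 /sat_and [/conj_map H1 Hs]] c Hc.
  have [m2 E2 /sat_and [/conj_flatten H2 Hr]] := ex_elim (block_leq L (isT : 0 <= 1)) E1.1 Hs.
  apply/negP => Hb; have := H2 c; rewrite mem_iota => /(_ Hc) /conj_map /(_ (iter (2 ^ L) ca init c)).
  rewrite mem_filter mem_iota Hb iter_ca_lt // => /(_ isT); apply; apply/bit_ctl_spec.
  apply: (reach_sound E2.1 Hi Hr) => // c0 Hc0; rewrite (ext_cell _ _ E2) //.
  by apply/bit_ctl_spec; apply: H1; rewrite mem_iota.
- move=> H.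
  apply: (ex_intro (P := fun i => i %% sg == init (i %/ sg))
    (block_leq L (isT : 1 <= 2)) (dvdn0 _)) => m1 E1 B1.
  have Z1 c s : c < C -> s < sg -> cell m1 (3 * L + 1) c s = (s == init c).
    move=> Hc Hs; rewrite /cell B1; last first.
      by rewrite -mulnBl; have -> : 3 * L + 2 - (3 * L + 1) = 1 by [lia]; rewrite mul1n cell_idx_lt.
    by rewrite modnMDl modn_small // divnMDl // divn_small // addn0.
  split.
    apply/conj_map => c; rewrite mem_iota => Hc.
    by apply/bit_ctl_spec; rewrite -/(cell m1 _ _ _) Z1.
  apply: (ex_intro (P := fun i => i %% sg == iter (2 ^ L) ca init (i %/ sg))
    (block_leq L (isT : 0 <= 1)) E1.1) => m2 E2 B2.
  have Z2 c s : c < C -> s < sg -> cell m2 (3 * L + 0) c s = (s == iter (2 ^ L) ca init c).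
    move=> Hc Hs; rewrite /cell B2; last first.
      by rewrite -mulnBl; have -> : 3 * L + 1 - (3 * L + 0) = 1 by [lia]; rewrite mul1n cell_idx_lt.
    by rewrite modnMDl modn_small // divnMDl // divn_small // addn0.
  split.
  + apply/conj_flatten => c; rewrite mem_iota => Hc; apply/conj_map => s.
    rewrite mem_filter mem_iota => /andP [Hb Hs] /bit_ctl_spec; rewrite -/(cell m2 _ _ _) Z2 // => /eqP Es.
    by move: Hb; rewrite Es; apply/negP/H.
  + apply: (reach_complete E2.1 Hi) => [c s Hc Hs|c Hc]; last by rewrite Z2 ?iter_ca_lt.
    by rewrite (ext_cell _ _ E2) // Z1 // => /eqP.
Qed.

End Savitch.

(** * Turing machines as cellular automata *)

Lemma ca_ext C bl delta f g : f =1 g -> ca C bl delta f =1 ca C bl delta g.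
Proof. by move=> E c; rewrite /ca !E. Qed.

Section Automaton.
Variable M : TM.

Definition csym : finType := (tm_sym M * option (tm_state M))%type.
Definition cblank : csym := (tm_blank M, None).
Definition halting (q : tm_state M) : bool := (q == tm_acc M) || (q == tm_rej M).

Definition incoming (mv : move) (s : csym) : option (tm_state M) :=
  if s is (g, Some q) then
    if halting q then None else
    match tm_delta q g, mv with
    | (q', _, MLeft), MLeft | (q', _, MRight), MRight => Some q'
    | _, _ => None
    end
  else None.

(** A cell without the head keeps its symbol and can only receive the head from a neighbour. A
    halting head is frozen, so that the final configuration persists. *)
Definition local (a b d : csym) : csym :=
  match b with
  | (g, Some q) => if halting q then b else
      let: (q', g', mv) := tm_delta q g in (g', if mv is MStay then Some q' else None)
  | (g, None) => (g, if incoming MRight a is Some q then Some q else incoming MLeft d)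
  end.

Definition code (s : csym) : nat := enum_rank s.
Definition decode (i : nat) : csym := nth cblank (enum csym) i.
Definition delta_code (a b d : nat) : nat := code (local (decode a) (decode b) (decode d)).

Lemma codeK s : decode (code s) = s.
Proof. by rewrite /decode /code nth_enum_rank. Qed.

Lemma code_lt s : code s < #|csym|.
Proof. exact: ltn_ord. Qed.

Definition content (c : cfg M) (p i : nat) : tm_sym M :=
  if i < p then nth (tm_blank M) (cf_left c) (p - i).-1
  else if i == p then cf_head c else nth (tm_blank M) (cf_right c) (i - p).-1.

Definition cell_of (c : cfg M) (p i : nat) : csym :=
  (content c p i, if i == p then Some (cf_st c) else None).

Definition caM (C : nat) : (nat -> nat) -> nat -> nat := ca C (code cblank) delta_code.

Lemma cell_of_blank c p i : i < p - size (cf_left c) \/ p + size (cf_right c) < i -> cell_of c p i = cblank.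
Proof.
move=> H; rewrite /cell_of /content /cblank.
case: (ltngtP i p) => Hp; last by lia.
- by rewrite nth_default //; lia.
- by rewrite nth_default //; lia.
Qed.

Definition next_pos (c : cfg M) (p : nat) : nat :=
  if halted c then p else
  match (tm_delta (cf_st c) (cf_head c)).2 with MLeft => p.-1 | MStay => p | MRight => p.+1 end.

(** The blank default in [head], together with [behead], makes a move beyond the visited cells no
    separate case. *)
Lemma content_left q q' l h r g p i :
  content (@Cfg M q' (behead l) (head (tm_blank M) l) (g :: r)) p i =
  if i == p.+1 then g else content (@Cfg M q l h r) p.+1 i.
Proof.
rewrite /content /=; case: (ltngtP i p) => Hi.
- have -> : (i == p.+1) = false by lia.
  have -> : (i < p.+1) = true by lia.
  have -> : (p.+1 - i).-1 = (p - i).-1.+1 by lia.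
  by case: l => //=; rewrite nth_nil.
- have -> : (i == p.+1) = ((i - p).-1 == 0) by lia.
  have -> : (i < p.+1) = false by lia.
  have -> : (i - p.+1).-1 = (i - p).-1.-1 by lia.
  by case: ((i - p).-1).
- by rewrite Hi ltnSn eqn_leq ltnn andbF subSnn; case: l.
Qed.

Lemma content_right q q' l h r g p i :
  content (@Cfg M q' (g :: l) (head (tm_blank M) r) (behead r)) p.+1 i =
  if i == p then g else content (@Cfg M q l h r) p i.
Proof.
rewrite /content /=; case: (ltngtP i p) => Hi.
- have -> : (i < p.+1) = true by lia.
  by have -> : (p.+1 - i).-1 = (p - i).-1.+1 by lia.
- have -> : (i == p.+1) = ((i - p).-1 == 0) by lia.
  have -> : (i < p.+1) = false by lia.
  have -> : (i - p.+1).-1 = (i - p).-1.-1 by lia.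
  by case: (i - p).-1 => [|k]; case: r => //= *; rewrite nth_nil.
- by rewrite Hi ltnSn subSnn.
Qed.

Lemma content_step (c : cfg M) p i : ~~ halted c -> 0 < p ->
  content (tm_step c) (next_pos c p) i = if i == p then (tm_delta (cf_st c) (cf_head c)).1.2 else content c p i.
Proof.
rewrite /next_pos /tm_step => /negPf ->; case: c => q l h r /=.
case: (tm_delta q h) => [[q' g] mv] /= Hp; case: mv => /=.
- by case: p Hp => // p _; rewrite -(content_left q q'); case: l.
- by rewrite /content /=; case: ltngtP.
- by rewrite -(content_right q q'); case: r.
Qed.

Lemma st_step (c : cfg M) : ~~ halted c -> cf_st (tm_step c) = (tm_delta (cf_st c) (cf_head c)).1.1.
Proof.
rewrite /tm_step => /negPf ->; case: (tm_delta _ _) => [[q' g] mv]; case: mv => //=.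
- by case: (cf_left c).
- by case: (cf_right c).
Qed.

Lemma content_head (c : cfg M) p : content c p p = cf_head c.
Proof. by rewrite /content ltnn eqxx. Qed.

Lemma local_step (c : cfg M) p i : 0 < p -> 0 < i ->
  local (cell_of c p i.-1) (cell_of c p i) (cell_of c p i.+1) = cell_of (tm_step c) (next_pos c p) i.
Proof.
move=> Hp Hi; case: (boolP (halted c)) => Hh.
  have Es : tm_step c = c by rewrite /tm_step Hh.
  have En : next_pos c p = p by rewrite /next_pos Hh.
  rewrite Es En /cell_of /local /incoming.
  have Hq : halting (cf_st c) by exact: Hh.
  by case: (i == p); case: (i.-1 == p); case: (i.+1 == p); rewrite /= ?Hq.
have Hq : halting (cf_st c) = false by exact: negPf.
rewrite [RHS]/cell_of content_step // st_step // /cell_of /next_pos (negPf Hh).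
case: (eqVneq i p) => [->|Hip] /=.
  rewrite Hq content_head; case: (tm_delta _ _) => [[q' g] mv] /=.
  by case: mv => /=; rewrite ?eqxx //; congr pair; case: eqP => //; lia.
case: (eqVneq i.-1 p) => Hi1.
  have -> : (i.+1 == p) = false by lia.
  rewrite /= Hq Hi1 content_head.
  by case: (tm_delta _ _) => [[q' g] mv] /=; case: mv => /=; congr pair; case: eqP => //; lia.
case: (eqVneq i.+1 p) => Hi2.
  rewrite /= Hq Hi2 content_head.
  by case: (tm_delta _ _) => [[q' g] mv] /=; case: mv => /=; congr pair; case: eqP => //; lia.
by case: (tm_delta _ _) => [[q' g] mv] /=; case: mv => /=; congr pair; case: eqP => //; lia.
Qed.

Lemma size_step (c : cfg M) p p0 : p <= p0 + size (cf_left c) -> p0 <= p + size (cf_right c) ->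
  next_pos c p <= p0 + size (cf_left (tm_step c)) /\ p0 <= next_pos c p + size (cf_right (tm_step c)).
Proof.
rewrite /next_pos /tm_step; case: halted => //; case: c => q l h r /=.
case: (tm_delta q h) => [[q' g] mv] /=; case: mv => //=.
- by case: l => [|x l] /=; lia.
- by case: r => [|x r] /=; lia.
Qed.

(** The margins keep the visited cells strictly inside the row before and after the step, so the
    pinned borders agree with the blank tape. *)
Lemma ca_step C (c : cfg M) p i : (size (cf_left c)).+1 < p -> (p + size (cf_right c)).+2 < C ->
  caM C (fun i => code (cell_of c p i)) i = code (cell_of (tm_step c) (next_pos c p) i).
Proof.
move=> Hl Hr; rewrite /caM /ca.
have Hsz : 0 < next_pos c p - size (cf_left (tm_step c)) /\ next_pos c p + size (cf_right (tm_step c)) < C.-1.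
  rewrite /next_pos /tm_step; case: halted; first by lia.
  case: c Hl Hr => q l h r /=; case: (tm_delta q h) => [[q' g] mv] /=; case: mv => /=; try lia.
  - by case: l => [|x l] /=; lia.
  - by case: r => [|x r] /=; lia.
case: (posnP i) => [->|Hi] /=; first by rewrite cell_of_blank //; left; lia.
case: (eqVneq i C.-1) => [->|Hi1] /=; first by rewrite cell_of_blank //; right; lia.
by rewrite /delta_code !codeK local_step //; lia.
Qed.

(** * Runs inside a bounded window and the number of configurations *)

Section Run.
Variables (C S p0 : nat) (w : seq bool).
Hypotheses (HS : forall t, tm_space (tm_run M w t) <= S) (Hp0 : S < p0) (HC : p0 + S < C.-1).

Fixpoint pos (t : nat) : nat := if t is t'.+1 then next_pos (tm_run M w t') (pos t') else p0.

Lemma pos_bounds t : [/\ (size (cf_left (tm_run M w t))).+1 < pos t,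
  (pos t + size (cf_right (tm_run M w t))).+2 < C &
  pos t < C].
Proof.
have H : pos t <= p0 + size (cf_left (tm_run M w t)) /\ p0 <= pos t + size (cf_right (tm_run M w t)).
  elim: t => [|t [H1 H2]]; first by rewrite /=; lia.
  exact: size_step.
by have := HS t; rewrite /tm_space; split; lia.
Qed.

Lemma ca_run t i : iter t (caM C) (fun i => code (cell_of (tm_init M w) p0 i)) i =
  code (cell_of (tm_run M w t) (pos t) i).
Proof.
elim: t i => [//|t IH] i; have [Hl Hr _] := pos_bounds t.
by rewrite iterS; apply: etrans (ca_ext _ _ _ IH i) _; exact: ca_step.
Qed.

Lemma st_halted_stable t t' : t <= t' -> halted (tm_run M w t) -> tm_run M w t' = tm_run M w t.
Proof.
move=> Ht Hh; rewrite /tm_run -(subnK Ht) iterD; elim: (t' - t) => //= n ->.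
by rewrite /tm_step -/(tm_run M w t) Hh.
Qed.

(** The configuration, head included, as an element of a finite type on which a step is a function;
    this opens the way to the pigeonhole argument. *)
Definition snap (t : nat) : {ffun 'I_C -> csym} :=
  [ffun i : 'I_C => cell_of (tm_run M w t) (pos t) i].

Definition snap_next (x : {ffun 'I_C -> csym}) : {ffun 'I_C -> csym} :=
  let f (i : nat) := if insub i is Some j then code (x j) else code cblank in
  [ffun i : 'I_C => decode (caM C f (val i))].

Lemma snap_iter t : snap t = iter t snap_next (snap 0).
Proof.
elim: t => // t IH; rewrite iterS -IH; apply/ffunP => i; rewrite !ffunE.
have [Hl Hr _] := pos_bounds t.
rewrite -[LHS]codeK -(ca_step _ Hl Hr); congr decode; apply: ca_ext => {}i.
case: insubP => [j _ Hj|]; first by rewrite ffunE Hj.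
(* Beyond the window the tape is blank, in agreement with the default in [snap_next]. *)
by rewrite -leqNgt => Hi; rewrite cell_of_blank //; right; lia.
Qed.

Lemma snap_state t t' : snap t = snap t' -> cf_st (tm_run M w t) = cf_st (tm_run M w t').
Proof.
have [_ _ Hp] := pos_bounds t.
move/ffunP/(_ (Ordinal Hp)); rewrite !ffunE /= /cell_of eqxx => -[_].
by case: eqP => // _ [].
Qed.

(** The snapshots form an orbit of a function on a finite type, so each of them occurs at an index
    below the size of that type; the state can be read off, as the head never leaves the window. *)
Lemma halt_bound t : halted (tm_run M w t) ->
  exists2 t', t' < #|csym| ^ C & cf_st (tm_run M w t') = cf_st (tm_run M w t).
Proof.
move=> Hh; have Hc : fconnect snap_next (snap 0) (snap t) by rewrite (snap_iter t) fconnect_iter.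
exists (findex snap_next (snap 0) (snap t)).
  apply: leq_trans (findex_max Hc) _.
  by rewrite /order; apply: leq_trans (max_card _) _; rewrite card_ffun card_ord.
by apply: snap_state; rewrite snap_iter iter_findex.
Qed.

Definition rejecting (i : nat) : bool :=
  if (decode i).2 is Some q then q != tm_acc M else false.

(** The machine has halted by step [2 ^ L] and stays where it is. The row then contains a single
    head, and acceptance means that no cell shows another state. *)
Lemma ca_accepts L : C * #|csym| <= L -> (exists t, halted (tm_run M w t)) ->
  (exists t, cf_st (tm_run M w t) = tm_acc M) <->
  forall i, i < C -> ~~ rejecting (iter (2 ^ L) (caM C) (fun i => code (cell_of (tm_init M w) p0 i)) i).
Proof.
move=> HL [t0 Ht0].
have Hacc : cf_st (tm_run M w (2 ^ L)) = tm_acc M <->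
    forall i, i < C -> ~~ rejecting (iter (2 ^ L) (caM C) (fun i => code (cell_of (tm_init M w) p0 i)) i).
  split=> [Ha i Hi|H].
  - by rewrite ca_run /rejecting codeK /cell_of; case: eqP => //= _; rewrite Ha eqxx.
  - have [_ _ Hp] := pos_bounds (2 ^ L); have := H _ Hp.
    by rewrite ca_run /rejecting codeK /cell_of eqxx /= negbK => /eqP.
rewrite -Hacc; split=> [[t Ht]|H]; last by exists (2 ^ L).
have [t1 Ht1 E1] := halt_bound Ht0.
have Hh1 : halted (tm_run M w t1) by rewrite /halted E1.
have Ht1L : t1 <= 2 ^ L.
  (* Bounding [#|csym|] by [2 ^ #|csym|] avoids logarithms. *)
  apply: ltnW; apply: leq_trans Ht1 _; apply: leq_trans (_ : (2 ^ #|csym|) ^ C <= _).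
    by case: (C) => // C'; rewrite leq_exp2r // ltnW // ltn_expl.
  by rewrite -expnM leq_exp2l // mulnC.
have Hht : halted (tm_run M w t) by rewrite /halted Ht eqxx.
rewrite (st_halted_stable Ht1L Hh1).
case: (leqP t t1) => Hle; first by rewrite (st_halted_stable Hle Hht).
by rewrite -(st_halted_stable (ltnW Hle) Hh1).
Qed.

End Run.
End Automaton.

(** * Loop programs on Turing machines *)

Section Fragments.
Variable sym : finType.
Variable blank : sym.

Definition tape := (seq sym * sym * seq sym)%type.

Definition mkt (l s : seq sym) : tape :=
  if s is h :: r then (l, h, r) else (l, blank, [::]).

Definition wm (g : sym) (mv : move) (t : tape) : tape :=
  let: (l, _, r) := t in
  match mv with
  | MStay => (l, g, r)
  | MLeft => if l is x :: l' then (l', x, g :: r) else ([::], blank, g :: r)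
  | MRight => mkt (g :: l) r
  end.

(** A machine with two exits; the Boolean carries the outcome of a test to [fIf] and [fLoop]. *)
Record frag := Frag {
  fstate : finType;
  f0 : fstate;
  fd : fstate -> sym -> (fstate + bool) * sym * move }.

Inductive run (F : frag) : fstate F -> tape -> nat -> bool -> tape -> Prop :=
| run_exit q l h r b g mv :
    fd q h = (inr b, g, mv) -> run q (l, h, r) 1 b (wm g mv (l, h, r))
| run_step q l h r q' g mv n b t' :
    fd q h = (inl q', g, mv) -> run q' (wm g mv (l, h, r)) n b t' ->
    run q (l, h, r) n.+1 b t'.

Lemma run_right (F : frag) (q q' : fstate F) g l h r n b t' :
  fd q h = (inl q', g, MRight) -> run q' (mkt (g :: l) r) n b t' ->
  run q (mkt l (h :: r)) n.+1 b t'.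
Proof. by move=> Hd Hr; apply: (run_step Hd). Qed.

Definition fIf (F G H : frag) : frag :=
  @Frag (fstate F + (fstate G + fstate H))%type (inl (f0 F))
    (fun q s => match q with
     | inl q => let: (x, g, mv) := fd q s in
         (match x with inl q' => inl (inl q')
          | inr b => inl (inr (if b then inl (f0 G) else inr (f0 H))) end, g, mv)
     | inr (inl q) => let: (x, g, mv) := fd q s in
         (match x with inl q' => inl (inr (inl q')) | inr b => inr b end, g, mv)
     | inr (inr q) => let: (x, g, mv) := fd q s in
         (match x with inl q' => inl (inr (inr q')) | inr b => inr b end, g, mv)
     end).

Lemma run_fIfG F G H q t n b t' : @run G q t n b t' -> @run (fIf F G H) (inr (inl q)) t n b t'.
Proof.
elim=> {q t n b t'} [q l h r b g mv Hd|q l h r q' g mv n b t' Hd _ IH].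
- by apply: run_exit; rewrite /= Hd.
- by apply: run_step IH; rewrite /= Hd.
Qed.

Lemma run_fIfH F G H q t n b t' : @run H q t n b t' -> @run (fIf F G H) (inr (inr q)) t n b t'.
Proof.
elim=> {q t n b t'} [q l h r b g mv Hd|q l h r q' g mv n b t' Hd _ IH].
- by apply: run_exit; rewrite /= Hd.
- by apply: run_step IH; rewrite /= Hd.
Qed.

Lemma run_fIf F G H q t n b t' n' b' t'' : @run F q t n b t' ->
  (if b then run (f0 G) t' n' b' t'' else run (f0 H) t' n' b' t'') ->
  @run (fIf F G H) (inl q) t (n + n') b' t''.
Proof.
elim=> {q t n b t'} [q l h r b g mv Hd|q l h r q' g mv n b t' Hd _ IH] HGH.
- apply: run_step; first by rewrite /= Hd.
  by case: b HGH Hd => HGH _; [apply: run_fIfG|apply: run_fIfH].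
- by apply: run_step (IH HGH); rewrite /= Hd.
Qed.

Definition fSeq (F G : frag) : frag := fIf F G G.

Lemma run_fSeq F G t n b t' n' b' t'' : run (f0 F) t n b t' -> run (f0 G) t' n' b' t'' ->
  run (f0 (fSeq F G)) t (n + n') b' t''.
Proof. by move=> HF HG; apply: run_fIf HF _; case: (b). Qed.

Definition fLoop (F : frag) : frag :=
  @Frag (fstate F) (f0 F)
    (fun q s => let: (x, g, mv) := fd q s in
       (match x with inl q' => inl q' | inr true => inl (f0 F) | inr false => inr true end, g, mv)).

(** Covers a single pass through [F]: an exit with [true] can be put in front of any later run of
    the loop, an exit with [false] ends it. Counting the passes is left to the caller. *)
Lemma run_fLoop F q t n b t' : @run F q t n b t' ->
  if b then forall n' b' t'', @run (fLoop F) (f0 F) t' n' b' t'' -> @run (fLoop F) q t (n + n') b' t''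
  else @run (fLoop F) q t n true t'.
Proof.
elim=> {q t n b t'} [q l h r b g mv Hd|q l h r q' g mv n b t' Hd _].
- case: b Hd => Hd; first by move=> n' b' t'' HL; apply: (run_step _ HL); rewrite /= Hd.
  by apply: run_exit; rewrite /= Hd.
- case: b => IH; first by move=> n' b' t'' HL; apply: (run_step _ (IH _ _ _ HL)); rewrite /= Hd.
  by apply: (run_step _ IH); rewrite /= Hd.
Qed.

Definition fOne (d : sym -> bool * sym * move) : frag :=
  @Frag unit tt (fun _ s => let: (e, g, mv) := d s in (if e then inr true else inl tt, g, mv)).

Lemma run_back (F : frag) (q : fstate F) lend b g l h r :
  (forall s, fd q s = if s == lend then (inr b, lend, MStay) else (inl q, s, MLeft)) ->
  lend \notin l -> run q (wm g MLeft (rcons l lend, h, r)) (size l).+1 b ([::], lend, rev l ++ g :: r).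
Proof.
move=> Hd; elim: l g h r => [|x l IH] g h r Hl.
  by apply: (@run_exit _ _ _ _ _ _ lend MStay); rewrite Hd eqxx.
move: Hl; rewrite inE negb_or => /andP [Hx Hl].
apply: (@run_step _ _ _ _ _ q x MLeft); first by rewrite Hd eq_sym (negPf Hx).
by rewrite rev_cons cat_rcons; apply: IH.
Qed.

Definition fBack (lend : sym) : frag :=
  fOne (fun s => if s == lend then (true, lend, MStay) else (false, s, MLeft)).

Lemma run_fBack lend g l h r : lend \notin l ->
  run (f0 (fBack lend)) (wm g MLeft (rcons l lend, h, r)) (size l).+1 true ([::], lend, rev l ++ g :: r).
Proof. by move=> Hl; apply: run_back Hl => s /=; case: ifP. Qed.

Lemma run_fOne_skip d l s r n b t' : (forall h, h \in s -> d h = (false, h, MRight)) ->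
  run (f0 (fOne d)) (mkt (rev s ++ l) r) n b t' -> run (f0 (fOne d)) (mkt l (s ++ r)) (size s + n) b t'.
Proof.
elim: s l => [|h s IH] l //= Hd Hr.
apply: (@run_right (fOne d) tt tt h); first by rewrite /= Hd // mem_head.
apply: IH => [h' Hh'|]; first by rewrite Hd // inE Hh' orbT.
by rewrite -cat_rcons -rev_cons.
Qed.

End Fragments.

Arguments fOne {sym}.
Arguments fSeq {sym}.

(** * Loop programs, their compilation and their running time *)

Section Programs.
Variables (lab K : finType) (l0 : lab).

Inductive test := TLt of K & K | TLab of K & pred lab.
Inductive prog := Out of seq bool | Seq of prog & prog | If of test & prog & prog | For of K & prog.

Definition env := {ffun K -> nat}.
Definition upd (e : env) (k : K) (i : nat) : env := [ffun k' => if k' == k then i else e k'].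

Definition teval (v : seq lab) (e : env) (t : test) : bool :=
  match t with TLt a b => e a < e b | TLab a P => P (nth l0 v (e a)) end.

Fixpoint eval (v : seq lab) (e : env) (p : prog) : seq bool :=
  match p with
  | Out s => s
  | Seq p q => eval v e p ++ eval v e q
  | If t p q => if teval v e t then eval v e p else eval v e q
  | For k p => flatten [seq eval v (upd e k i) p | i <- iota 0 (size v)]
  end.

Definition tok (A : {set K}) (t : test) : bool :=
  match t with TLt a b => (a \in A) && (b \in A) | TLab a _ => a \in A end.

Fixpoint ok (A : {set K}) (p : prog) : bool :=
  match p with
  | Out _ => true
  | Seq p q => ok A p && ok A q
  | If t p q => [&& tok A t, ok A p & ok A q]
  | For k p => (k \notin A) && ok (k |: A) p
  end.

(* A mark that is not on the tape has the position [size v]. *)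
Definition active (v : seq lab) (A : {set K}) (e : env) : Prop :=
  forall k, if k \in A then is_true (e k < size v) else e k = size v.

Lemma active_upd v A e k i : active v A e -> i < size v -> active v (k |: A) (upd e k i).
Proof. by move=> H Hi k'; rewrite !inE ffunE; case: eqP => //= _; exact: H. Qed.

Definition cellT := (lab * {set K})%type.
Definition sym : finType := option (bool + (bool + cellT)).
Definition blankS : sym := None.
Definition bitS (b : bool) : sym := Some (inl b).
Definition lend : sym := Some (inr (inl false)).
Definition rend : sym := Some (inr (inl true)).
Definition cellS (c : cellT) : sym := Some (inr (inr c)).

Notation tapeS := (tape sym).
Notation fragS := (frag sym).
Notation runS := (@run sym blankS).

(** Compiled programs start and end in this shape. The output grows to the right of [rend], apart
    from the cells that carry the loop marks. *)
Definition home (cs : seq cellT) (o : seq bool) : tapeS :=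
  ([::], lend, map cellS cs ++ rend :: map bitS o).

Section Mealy.
Variables (D : finType) (d0 : D) (tr : D -> cellT -> D * cellT) (out : D -> bool).

(** One sweep of a Mealy machine over the cells and back, with the last state deciding the exit. All
    tests and all moves of marks are instances. *)
Definition fScan : fragS :=
  @Frag sym (D + bool)%type (inl d0) (fun q s => match q with
    | inl d => match s with
       | Some (inr (inr c)) => (inl (inl (tr d c).1), cellS (tr d c).2, MRight)
       | Some (inr (inl true)) => (inl (inr (out d)), rend, MLeft)
       | _ => (inl (inl d), s, MRight) end
    | inr b => if s == lend then (inr b, lend, MStay) else (inl (inr b), s, MLeft)
    end).

Fixpoint mealy (d : D) (cs : seq cellT) : D * seq cellT :=
  if cs is c :: cs' then
    ((mealy (tr d c).1 cs').1, (tr d c).2 :: (mealy (tr d c).1 cs').2)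
  else (d, [::]).

Lemma size_mealy d cs : size (mealy d cs).2 = size cs.
Proof. by elim: cs d => //= c cs IH d; rewrite IH. Qed.

Lemma mealy_cat d cs1 cs2 : mealy d (cs1 ++ cs2) =
  ((mealy (mealy d cs1).1 cs2).1, (mealy d cs1).2 ++ (mealy (mealy d cs1).1 cs2).2).
Proof. by elim: cs1 d => [|c cs1 IH] d /=; [case: mealy|rewrite IH]. Qed.

Lemma run_scan_cells d cs l r n b t' :
  @runS fScan (inl (mealy d cs).1) (mkt blankS (rev (map cellS (mealy d cs).2) ++ l) r) n b t' ->
  @runS fScan (inl d) (mkt blankS l (map cellS cs ++ r)) (size cs + n) b t'.
Proof.
elim: cs d l => [|c cs IH] d l //= Hr.
apply: (@run_right _ _ fScan _ (inl (tr d c).1) (cellS (tr d c).2)) => //.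
by apply: IH; rewrite -cat_rcons -rev_cons.
Qed.

Lemma lend_notin_cells cs : lend \notin map cellS cs.
Proof. by apply/mapP => -[]. Qed.

Lemma run_fScan cs o :
  runS (f0 fScan) (home cs o) (2 * size cs + 3) (out (mealy d0 cs).1) (home (mealy d0 cs).2 o).
Proof.
rewrite /home (_ : 2 * size cs + 3 = (size cs + (size cs).+2).+1); last by lia.
apply: (@run_right _ _ fScan _ (inl d0) lend [::]) => //.
apply: run_scan_cells.
apply: (@run_step _ _ fScan _ _ _ _ (inr (out (mealy d0 cs).1)) rend MLeft) => //.
have := @run_back _ blankS fScan (inr (out (mealy d0 cs).1)) lend _ rend (rev (map cellS (mealy d0 cs).2)) rend (map bitS o)
  (fun=> erefl).
by rewrite mem_rev lend_notin_cells revK size_rev size_map size_mealy cats1; apply.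
Qed.
End Mealy.

Definition fApp (b : bool) : fragS :=
  fSeq (fOne (fun s => if s == blankS then (true, bitS b, MLeft) else (false, s, MRight)))
       (fBack lend).

Lemma run_fApp b cs o :
  runS (f0 (fApp b)) (home cs o) (2 * (size cs + size o) + 5) true (home cs (rcons o b)).
Proof.
have [R [x [HR HRb HRl]]] : exists R x, [/\ map cellS cs ++ rend :: map bitS o = rcons R x,
    all (fun h => h != blankS) (lend :: rcons R x) & lend \notin rcons R x].
  case/lastP E : (map cellS cs ++ rend :: map bitS o) => [|R x]; first by case: (cs) E.
  exists R, x; split=> //; rewrite -E /= ?all_cat /= ?mem_cat ?inE.
  - by apply/andP; split; apply/allP => y /mapP [? _ ->].
  - by rewrite negb_or lend_notin_cells /=; apply/mapP => -[].
have Hsz : size R = size cs + size o.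
  by have := congr1 size HR; rewrite size_cat /= size_rcons !size_map addnS => -[].
rewrite (_ : 2 * (size cs + size o) + 5 = (size (lend :: rcons R x) + 1) + (size R).+2); last by rewrite /= size_rcons Hsz; lia.
rewrite {1}/home HR.
apply: (@run_fSeq _ _ _ _ _ _ true (wm blankS (bitS b) MLeft (rev (lend :: rcons R x), blankS, [::]))).
- have := @run_fOne_skip _ blankS (fun s => if s == blankS then (true, bitS b, MLeft) else (false, s, MRight))
    [::] (lend :: rcons R x) [::] 1 true (wm blankS (bitS b) MLeft (rev (lend :: rcons R x), blankS, [::])).
  rewrite !cats0; apply; first by move=> h /(allP HRb) Hh; rewrite (negPf Hh).
  by apply: run_exit.
- have := @run_fBack _ blankS lend (bitS b) (x :: rev R) blankS [::].
  rewrite -rev_rcons mem_rev revK size_rev size_rcons -rev_cons => /(_ HRl).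
  by rewrite /home map_rcons (_ : map cellS cs ++ _ = rcons R x ++ [:: bitS b]) // -HR cats1 rcons_cat.
Qed.
Definition fSkip : fragS := fOne (fun s => (true, s, MStay)).

Lemma run_fSkip cs o : runS (f0 fSkip) (home cs o) 1 true (home cs o).
Proof. exact: (@run_exit _ _ fSkip tt [::] lend _ true lend MStay). Qed.

Definition cells (v : seq lab) (e : env) : seq cellT :=
  [seq (nth l0 v i, [set k | e k == i]) | i <- iota 0 (size v)].

Lemma size_cells v e : size (cells v e) = size v.
Proof. by rewrite size_map size_iota. Qed.

(** Two marks are compared by which one the sweep meets first; looking for [b] before [a] makes
    equal positions answer [false]. *)
Definition tr_lt (a b : K) (d : option bool) (c : cellT) : option bool * cellT :=
  (if d is Some _ then d else
   if b \in c.2 then Some false else if a \in c.2 then Some true else None, c).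
Definition tr_lab (a : K) (P : pred lab) (d : option bool) (c : cellT) : option bool * cellT :=
  (if d is Some _ then d else if a \in c.2 then Some (P c.1) else None, c).
Definition tr_set (k : K) (d : bool) (c : cellT) : bool * cellT :=
  (false, (c.1, if d then k |: c.2 else c.2)).
(* [Some false]: the mark has just been lifted; [Some true]: it has been put down again. *)
Definition tr_adv (k : K) (d : option bool) (c : cellT) : option bool * cellT :=
  match d with
  | None => if k \in c.2 then (Some false, (c.1, c.2 :\ k)) else (None, c)
  | Some false => (Some true, (c.1, k |: c.2))
  | Some true => (Some true, c)
  end.
Definition is_done (d : option bool) : bool := d == Some true.

Fixpoint compile (p : prog) : fragS :=
  match p with
  | Out s => foldr (fun b F => fSeq (fApp b) F) fSkip s
  | Seq p q => fSeq (compile p) (compile q)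
  | If (TLt a b) p q => fIf (fScan None (tr_lt a b) is_done) (compile p) (compile q)
  | If (TLab a P) p q => fIf (fScan None (tr_lab a P) is_done) (compile p) (compile q)
  | For k p => fSeq (fScan true (tr_set k) xpredT)
                 (fLoop (fSeq (compile p) (fScan None (tr_adv k) is_done)))
  end.

Lemma mealy_fix (D : finType) (tr : D -> cellT -> D * cellT) d cs :
  (forall c, c \in cs -> tr d c = (d, c)) -> mealy tr d cs = (d, cs).
Proof.
elim: cs => //= c cs IH H; rewrite H ?mem_head //= IH // => c' Hc'.
by apply: H; rewrite inE Hc' orbT.
Qed.

Lemma mealy_const (D : finType) (tr : D -> cellT -> D * cellT) d cs :
  (forall d c, (tr d c).2 = c) -> (mealy tr d cs).2 = cs.
Proof. by move=> H; elim: cs d => //= c cs IH d; rewrite H IH. Qed.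

Lemma mealy_lt v (e : env) a b : e a < size v -> e b < size v ->
  is_done (mealy (tr_lt a b) None (cells v e)).1 = (e a < e b).
Proof.
move=> Ha Hb; rewrite /cells.
suff H n j : j <= e a -> j <= e b -> e a < j + n ->
  (mealy (tr_lt a b) None [seq (nth l0 v i, [set k | e k == i]) | i <- iota j n]).1 = Some (e a < e b).
  by rewrite H //; case: (e a < e b).
elim: n j => [|n IH] j Hja Hjb Hjn; first by lia.
rewrite /= !inE; case: (eqVneq (e b) j) => Eb; first by rewrite mealy_fix // Eb ltnNge Hja.
case: (eqVneq (e a) j) => Ea; first by rewrite mealy_fix //; congr Some; lia.
by rewrite IH //; lia.
Qed.

Lemma mealy_lab v (e : env) a P : e a < size v ->
  is_done (mealy (tr_lab a P) None (cells v e)).1 = P (nth l0 v (e a)).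
Proof.
move=> Ha; rewrite /cells.
suff H n j : j <= e a -> e a < j + n ->
  (mealy (tr_lab a P) None [seq (nth l0 v i, [set k | e k == i]) | i <- iota j n]).1 = Some (P (nth l0 v (e a))).
  by rewrite H //; case: (P _).
elim: n j => [|n IH] j Hja Hjn; first by lia.
rewrite /= !inE; case: (eqVneq (e a) j) => Ea; first by rewrite mealy_fix // Ea.
by rewrite IH //; lia.
Qed.

Lemma mealy_set v (e : env) k : 0 < size v -> e k = size v ->
  (mealy (tr_set k) true (cells v e)).2 = cells v (upd e k 0).
Proof.
rewrite /cells; case E : (size v) => [//|n] _ Ek /=.
rewrite mealy_fix; last by move=> [l M] _.
congr (_ :: _) => /=.
  by congr pair; apply/setP => k'; rewrite !inE ffunE; case: (eqVneq k' k) => [->|].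
apply/eq_in_map => i; rewrite mem_iota => Hi; congr pair; apply/setP => k'; rewrite !inE ffunE.
by case: (eqVneq k' k) => // ->; rewrite Ek; lia.
Qed.

(** On the last cell the mark is lifted and not put down again: it gets the position [size v] of an
    absent mark, which ends the loop and restores the environment. *)
Lemma mealy_adv v (e : env) k : e k < size v ->
  mealy (tr_adv k) None (cells v e) = (Some (e k < (size v).-1), cells v (upd e k (e k).+1)).
Proof.
move=> Hk; have [m Em] : exists m, size v = e k + m.+1.
  by exists (size v - (e k).+1); rewrite addnS -addSn subnKC.
have E0 : mealy (tr_adv k) None [seq (nth l0 v i, [set k' | e k' == i]) | i <- iota 0 (e k)] =
    (None, [seq (nth l0 v i, [set k' | e k' == i]) | i <- iota 0 (e k)]).
  apply: mealy_fix => c /mapP [i]; rewrite mem_iota => Hi ->; rewrite /tr_adv inE; case: eqP => // Ei.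
  by rewrite Ei add0n ltnn andbF in Hi.
rewrite /cells Em iotaD !map_cat mealy_cat E0.
rewrite add0n /= inE eqxx.
have Eout i : i != e k -> i != (e k).+1 ->
    [set k' | e k' == i] = [set k' | upd e k (e k).+1 k' == i].
  move=> H1 H2; apply/setP => k'; rewrite !inE ffunE; case: (eqVneq k' k) => // ->.
  by rewrite eq_sym (negPf H1) eq_sym (negPf H2).
have Ek : [set k' | e k' == e k] :\ k = [set k' | upd e k (e k).+1 k' == e k].
  by apply/setP => k'; rewrite !inE ffunE; case: (eqVneq k' k) => [->|] //=; rewrite eqn_leq ltnn.
have E1 : [seq (nth l0 v i, [set k' | e k' == i]) | i <- iota 0 (e k)] =
    [seq (nth l0 v i, [set k' | upd e k (e k).+1 k' == i]) | i <- iota 0 (e k)].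
  by apply/eq_in_map => i; rewrite mem_iota => Hi; rewrite Eout //; lia.
rewrite E1 Ek; case: m Em => [|n] Em /=.
  by congr (Some _, _); lia.
rewrite mealy_fix; last by move=> [].
rewrite /=; congr (Some _, _ ++ _ :: _ :: _); first by lia.
  by congr pair; apply/setP => k'; rewrite !inE ffunE; case: (eqVneq k' k) => [->|] //=; rewrite ?eqxx.
by apply/eq_in_map => i; rewrite mem_iota => Hi; rewrite Eout //; lia.
Qed.

Fixpoint out_bound (p : prog) (N : nat) : nat :=
  match p with
  | Out s => size s
  | Seq p q | If _ p q => out_bound p N + out_bound q N
  | For _ p => N * out_bound p N
  end.

(** The argument [o] is the length of the output so far, since appending a bit walks over all of
    it. *)
Fixpoint time_bound (p : prog) (N o : nat) : nat :=
  match p with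
  | Out s => size s * (2 * (N + (o + size s)) + 5) + 1
  | Seq p q => time_bound p N o + time_bound q N (o + out_bound p N)
  | If _ p q => 2 * N + 3 + (time_bound p N o + time_bound q N o)
  | For _ p => 2 * N + 3 + N * (time_bound p N (o + N * out_bound p N) + (2 * N + 3))
  end.

Lemma time_bound_mono p N o o' : o <= o' -> time_bound p N o <= time_bound p N o'.
Proof.
elim: p o o' => [s|p IHp q IHq|t p IHp q IHq|k p IH] o o' Ho /=.
- by rewrite leq_add2r leq_mul2l; apply/orP; right; lia.
- by apply: leq_add; [exact: IHp|apply: IHq; rewrite leq_add2r].
- by rewrite leq_add2l; apply: leq_add; [exact: IHp|exact: IHq].
- by rewrite leq_add2l leq_mul2l; apply/orP; right; rewrite leq_add2r; apply: IH; rewrite leq_add2r.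
Qed.

Lemma size_eval v e p : size (eval v e p) <= out_bound p (size v).
Proof.
elim: p e => [s|p IHp q IHq|t p IHp q IHq|k p IH] e //=.
- by rewrite size_cat leq_add.
- case: ifP => _; [apply: leq_trans (IHp e) _|apply: leq_trans (IHq e) _]; lia.
- rewrite -[X in X * _](size_iota 0 (size v)); elim: (iota _ _) => //= i l IHl.
  by rewrite size_cat mulSn leq_add.
Qed.

Lemma upd_upd e k i j : upd (upd e k i) k j = upd e k j.
Proof. by apply/ffunP => k'; rewrite !ffunE; case: eqP. Qed.

Lemma run_compile p A v e o : 0 < size v -> ok A p -> active v A e ->
  exists2 t, t <= time_bound p (size v) (size o) &
    runS (f0 (compile p)) (home (cells v e) o) t true (home (cells v e) (o ++ eval v e p)).
Proof.
move=> Hv; elim: p A e o => [s|p IHp q IHq|t p IHp q IHq|k p IH] A e o Hok He.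
- suff [t Ht Hr] : exists2 t, t <= size s * (2 * (size v + (size o + size s)) + 5) + 1 &
      runS (f0 (compile (Out s))) (home (cells v e) o) t true (home (cells v e) (o ++ s)) by exists t.
  elim: s o {Hok} => [|b s IHs] o; first by exists 1; rewrite ?cats0 //; exact: run_fSkip.
  have [t Ht Hr] := IHs (rcons o b); rewrite cat_rcons in Hr.
  exists (2 * (size (cells v e) + size o) + 5 + t); last exact: run_fSeq (run_fApp b (cells v e) o) Hr.
  by move: Ht; rewrite size_cells size_rcons /= => Ht; nia.
- move: Hok => /= /andP [Hp Hq].
  have [t1 Ht1 Hr1] := IHp A e o Hp He.
  have [t2 Ht2 Hr2] := IHq A e (o ++ eval v e p) Hq He.
  exists (t1 + t2); last by rewrite catA; exact: run_fSeq Hr1 Hr2.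
  apply: leq_add => //; apply: leq_trans Ht2 _; apply: time_bound_mono.
  by rewrite size_cat leq_add2l size_eval.
- move: Hok => /= /and3P [Ht Hp Hq].
  have [t1 Ht1 Hr1] := IHp A e o Hp He; have [t2 Ht2 Hr2] := IHq A e o Hq He.
  exists (2 * size v + 3 + (if teval v e t then t1 else t2)).
    by rewrite leq_add2l; case: ifP => _; lia.
  have HA k : k \in A -> e k < size v by move=> Hk; have := He k; rewrite Hk.
  case: t Ht => [a b|a P] /=.
  + move=> /andP [/HA Ha /HA Hb].
    have := run_fScan None (tr_lt a b) is_done (cells v e) o.
    rewrite mealy_const ?mealy_lt ?size_cells //.
    by case: (e a < e b) => Hs; exact: run_fIf Hs _.
  + move=> /HA Ha.
    have := run_fScan None (tr_lab a P) is_done (cells v e) o.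
    rewrite mealy_const ?mealy_lab ?size_cells //.
    by case: (P _) => Hs; exact: run_fIf Hs _.
- move: Hok => /= /andP [Hk Hp].
  have Ek : e k = size v by have := He k; rewrite (negPf Hk).
  have Eup : upd e k (size v) = e by apply/ffunP => k'; rewrite ffunE; case: eqP => // ->.
  set Z := out_bound p (size v); set B := time_bound p (size v) (size o + size v * Z) + (2 * size v + 3).
  (* The passes still to be made are counted by [n.+1]; the hypothesis on [o'] bounds the output at
     every later pass, so that each pass costs at most [B]. *)
  suff H n i o' : i + n.+1 = size v -> size o' + n.+1 * Z <= size o + size v * Z ->
    exists2 t, t <= n.+1 * B &
      runS (f0 (fLoop (fSeq (compile p) (fScan None (tr_adv k) is_done)))) (home (cells v (upd e k i)) o') t true
       (home (cells v e) (o' ++ flatten [seq eval v (upd e k j) p | j <- iota i n.+1])).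
    have [t Ht Hr] := H (size v).-1 0 o ltac:(lia) ltac:(by rewrite prednK).
    rewrite prednK // in Hr Ht.
    exists (2 * size v + 3 + t); first by rewrite leq_add2l.
    have := run_fScan true (tr_set k) xpredT (cells v e) o.
    by rewrite mealy_set // size_cells => Hs; apply: run_fSeq Hs Hr.
  elim: n i o' => [|n IHn] i o' Hi Ho'.
  + have Hact : active v (k |: A) (upd e k i) by apply: active_upd => //; lia.
    have [t1 Ht1 Hr1] := IH _ _ o' Hp Hact.
    have := run_fScan None (tr_adv k) is_done (cells v (upd e k i)) (o' ++ eval v (upd e k i) p).
    have Ei : upd e k i k = i by rewrite ffunE eqxx.
    rewrite mealy_adv ?Ei; last by lia.
    rewrite upd_upd size_cells (_ : i < _ = false); last by lia.
    rewrite (_ : i.+1 = size v) ?Eup; last by lia.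
    move=> /= Hs; have := run_fLoop (run_fSeq Hr1 Hs) => /= Hl.
    exists (t1 + (2 * size v + 3)); last by rewrite cats0.
    rewrite mul1n leq_add2r; apply: leq_trans Ht1 _; apply: time_bound_mono; lia.
  + have Hact : active v (k |: A) (upd e k i) by apply: active_upd => //; lia.
    have [t1 Ht1 Hr1] := IH _ _ o' Hp Hact.
    have := run_fScan None (tr_adv k) is_done (cells v (upd e k i)) (o' ++ eval v (upd e k i) p).
    have Ei : upd e k i k = i by rewrite ffunE eqxx.
    rewrite mealy_adv ?Ei; last by lia.
    rewrite upd_upd size_cells (_ : i < _ = true); last by lia.
    move=> /= Hs; have := run_fLoop (run_fSeq Hr1 Hs) => /= Hl.
    have Hsz := size_eval v (upd e k i) p.
    have [|t2 Ht2 Hr2] := IHn i.+1 (o' ++ eval v (upd e k i) p) ltac:(lia).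
      by rewrite size_cat; rewrite mulSn in Ho'; rewrite -/Z in Hsz; lia.
    exists (t1 + (2 * size v + 3) + t2); last by rewrite -catA in Hr2; apply: Hl.
    rewrite mulSn; apply: leq_add => //; rewrite leq_add2r; apply: leq_trans Ht1 _; apply: time_bound_mono; lia.
Qed.

End Programs.

(** * Polynomial bounds *)

Definition poly (f : nat -> nat) : Prop := exists c d, forall N, 0 < N -> f N <= c * N ^ d.

Lemma poly_const c : poly (fun=> c).
Proof. by exists c, 0 => N _; rewrite muln1. Qed.

Lemma poly_id : poly id.
Proof. by exists 1, 1 => N _; rewrite mul1n. Qed.

Lemma poly_add f g : poly f -> poly g -> poly (fun N => f N + g N).
Proof.
move=> [c [d H]] [c' [d' H']]; exists (c + c'), (d + d') => N HN.
have := H N HN; have := H' N HN; rewrite expnD.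
have : 0 < N ^ d by rewrite expn_gt0 HN.
have : 0 < N ^ d' by rewrite expn_gt0 HN.
move: (N ^ d) (N ^ d') => x y; nia.
Qed.

Lemma poly_mul f g : poly f -> poly g -> poly (fun N => f N * g N).
Proof.
move=> [c [d H]] [c' [d' H']]; exists (c * c'), (d + d') => N HN.
by rewrite expnD mulnACA leq_mul ?H ?H'.
Qed.

Ltac poly_tac := repeat first
  [apply: poly_const | apply: poly_id | apply: poly_add | apply: poly_mul | assumption].

Lemma out_poly lab K (p : prog lab K) : poly (out_bound p).
Proof. by elim: p => *; rewrite /out_bound -/out_bound; poly_tac. Qed.

(** Linearity in the output length is the form that survives composition: a later part starts with
    an output longer by at most a polynomial in [N]. *)
Lemma time_poly lab K (p : prog lab K) :
  exists2 g, poly g & forall N o, 0 < N -> time_bound p N o <= g N * o.+1.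
Proof.
elim: p => [s|p [g Hg IHp] q [g' Hg' IHq]|t p [g Hg IHp] q [g' Hg' IHq]|k p [g Hg IH]].
- exists (fun N => size s * (2 * N + (2 * size s + 7)) + 1); first by poly_tac.
  by move=> N o HN /=; nia.
- exists (fun N => g N + g' N * (out_bound p N + 1)).
    by have Hz := out_poly p; poly_tac.
  move=> N o HN /=; apply: leq_trans (leq_add (IHp N o HN) (IHq N _ HN)) _.
  by move: (out_bound p N) (g N) (g' N) => z x y; nia.
- exists (fun N => 2 * N + 3 + (g N + g' N)); first by poly_tac.
  move=> N o HN /=; have := IHp N o HN; have := IHq N o HN.
  by move: (time_bound p N o) (time_bound q N o) (g N) (g' N) => a b x y; nia.
- exists (fun N => 2 * N + 3 + N * (g N * (N * out_bound p N + 1) + (2 * N + 3))).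
    by have Hz := out_poly p; poly_tac.
  move=> N o HN /=; have Ha := IH N (o + N * out_bound p N) HN.
  have : N * time_bound p N (o + N * out_bound p N) <= N * (g N * (o + N * out_bound p N).+1).
    by rewrite leq_mul2l Ha orbT.
  rewrite mulnDr; move: (N * time_bound p N _) => a.
  by move: (N * out_bound p N) (g N) => b x; nia.
Qed.

(** * From loop programs to polynomial-time functions *)

(* The first component is [None] at position 0, [Some (inr o)] at position 1, where [o] is the
   first input bit, if any, and [Some (inl b)] afterwards; the second one flags the last position. *)
Definition label : finType := (option (bool + option bool) * bool)%type.

Definition labels (w : seq bool) : seq label :=
  let x := Some (inr (ohead w)) in let s := [seq Some (inl b) | b <- behead w] in
  (None, false) :: rcons [seq (y, false) | y <- belast x s] (last x s, true).

Lemma size_labels w : size (labels w) = (size w).-1.+2.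
Proof. by rewrite /= size_rcons !size_map size_belast size_map size_behead. Qed.

Section Machine.
Variable K : finType.
Notation sym := (sym label K).
Notation blankS := (blankS label K).
Notation lend := (lend label K).
Notation rend := (rend label K).
Notation runS := (@run sym blankS).

Definition bit_of (s : sym) : option bool := if s is Some (inl b) then Some b else None.

(** The cell of position 0 is written to the left of the input, and position 1 exists even if the
    input is empty; so there are always at least two positions, and numbers can be written in that
    base. *)
Definition fInit : frag sym :=
  fSeq (fOne (fun s => (true, cellS ((Some (inr (bit_of s)), false), set0), MLeft)))
 (fSeq (fOne (fun s => (true, cellS ((None, false), set0), MLeft)))
 (fSeq (fOne (fun s => (true, lend, MRight)))
 (fSeq (fOne (fun s => match s with
    | Some (inl b) => (false, cellS ((Some (inl b), false), set0), MRight)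
    | Some (inr (inr _)) => (false, s, MRight)
    | _ => (true, rend, MLeft) end))
 (fSeq (fOne (fun s => match s with
    | Some (inr (inr c)) => (true, cellS ((c.1.1, true), c.2), MLeft)
    | _ => (true, s, MLeft) end))
  (fBack lend))))).

Definition init_tape (w : seq bool) : tape sym := mkt blankS [::] (map (bitS label K) w).

Lemma cells_labels w :
  cells (None, false) (labels w) [ffun k : K => size (labels w)] = [seq (l, set0) | l <- labels w].
Proof.
rewrite /cells -[in RHS](mkseq_nth (None, false) (labels w)) /mkseq -map_comp.
apply/eq_in_map => i; rewrite mem_iota => Hi; congr pair.
by apply/setP => k; rewrite !inE ffunE; apply/negbTE; rewrite eq_sym neq_ltn; case/andP: Hi => _ ->.
Qed.

Lemma run_one (d : sym -> bool * sym * move) t g mv t' :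
  d t.1.2 = (true, g, mv) -> wm blankS g mv t = t' -> runS (f0 (fOne d)) t 1 true t'.
Proof. by case: t => [[l h] r] /= H <-; apply: (@run_exit _ _ (fOne d)); rewrite /= H. Qed.

Lemma run_fInit w : exists2 t, t <= 3 * size w + 20 &
  runS (f0 fInit) (init_tape w) t true (home [seq (l, set0) | l <- labels w] [::]).
Proof.
pose cl (y : option (bool + option bool)) : sym := cellS ((y, false), set0).
set x := Some (inr (ohead w)) : option (bool + option bool).
set s := [seq Some (inl b) | b <- behead w] : seq (option (bool + option bool)).
pose bits := map (bitS label K) (behead w).
pose cells1 := [:: cl None, cl x & map cl s].
have [R [z [HR Hz]]] : exists R z, cells1 = rcons (map cl R) (cl z) /\
    labels w = rcons [seq (y, false) | y <- R] (z, true).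
  exists (None :: belast x s), (last x s); split=> //.
  by rewrite -map_rcons /= -lastI.
have step1 : runS (f0 (fOne (fun s => (true, cellS ((Some (inr (bit_of s)), false), set0), MLeft))))
    (init_tape w) 1 true ([::], blankS, cl x :: bits).
  by rewrite /x /bits /init_tape; case: w {x s bits cells1 HR Hz R z} => [|b w]; exact: (run_one erefl erefl).
have step2 : runS (f0 (fOne (fun s => (true, cellS ((None, false), set0), MLeft))))
    ([::], blankS, cl x :: bits) 1 true ([::], blankS, [:: cl None, cl x & bits]) by exact: (run_one erefl erefl).
have step3 : runS (f0 (fOne (fun s => (true, lend, MRight))))
    ([::], blankS, [:: cl None, cl x & bits]) 1 true (mkt blankS [:: lend] [:: cl None, cl x & bits]) by exact: (run_one erefl erefl).
set d4 := fun s : sym => match s with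
    | Some (inl b) => (false, cellS ((Some (inl b), false), set0), MRight)
    | Some (inr (inr _)) => (false, s, MRight)
    | _ => (true, rend, MLeft) end.
have step4 : runS (f0 (fOne d4)) (mkt blankS [:: lend] [:: cl None, cl x & bits]) (2 + (size w).-1 + 1) true
    (wm blankS rend MLeft (rcons (rev cells1) lend, blankS, [::])).
  have Hb u l : runS (f0 (fOne d4)) (mkt blankS l (map (bitS label K) u)) (size u + 1) true
     (wm blankS rend MLeft (rev (map cl (map (Some \o inl) u)) ++ l, blankS, [::])).
    elim: u l => [|b u IHu] l; first by rewrite add0n; apply: (@run_one _ _ rend MLeft).
    rewrite /= addSn; apply: (@run_right _ _ (fOne d4) tt tt (cl (Some (inl b)))) => //.
    by rewrite rev_cons cat_rcons; apply: IHu.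
  rewrite -addnA add2n; do 2 apply: (@run_right _ _ (fOne d4) tt tt) => //.
  have := Hb (behead w) [:: cl x; cl None; lend]; rewrite size_behead.
  by rewrite /cells1 /s rev_cons rev_cons -!cats1 -!catA.
have Hne : lend \notin rev (map cl R) by rewrite mem_rev; apply/mapP => -[].
set d5 := fun s : sym => match s with
    | Some (inr (inr c)) => (true, cellS ((c.1.1, true), c.2), MLeft)
    | _ => (true, s, MLeft) end.
have step5 : runS (f0 (fOne d5)) (wm blankS rend MLeft (rcons (rev cells1) lend, blankS, [::])) 1 true
    (wm blankS (cellS ((z, true), set0)) MLeft (rcons (rev (map cl R)) lend, blankS, [:: rend])).
  by rewrite HR rev_rcons; apply: (@run_one _ _ (cellS ((z, true), set0)) MLeft).
have step6 := run_fBack blankS (cellS ((z, true), set0)) blankS [:: rend] Hne.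
exists (1 + (1 + (1 + (2 + (size w).-1 + 1 + (1 + (size (rev (map cl R))).+1))))).
  have := congr1 size Hz; rewrite size_labels size_rcons size_rev !size_map; lia.
have -> : home [seq (l, set0) | l <- labels w] [::] = ([::], lend, rev (rev (map cl R)) ++ [:: cellS ((z, true), set0); rend]).
  by rewrite /home Hz !map_rcons revK cat_rcons -!map_comp.
by do 5 (apply: run_fSeq; first eassumption).
Qed.

(** The output of a machine is read from its head onwards, so the head has to stop just behind
    [rend]. *)
Definition fEnd : frag sym := fOne (fun s => (s == rend, s, MRight)).

Lemma run_fEnd cs o : runS (f0 fEnd) (home cs o) (size cs + 2) true
   (mkt blankS (rend :: rev (lend :: map (@cellS label K) cs)) (map (bitS label K) o)).
Proof.
have := @run_fOne_skip _ blankS (fun s => (s == rend, s, MRight)) [::]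
  (lend :: map (@cellS label K) cs) (rend :: map (bitS label K) o) 1 true.
rewrite /= size_map addSn -addnS => H; apply: H => [h|].
  by rewrite inE => /predU1P [->//|/mapP [c _ ->]].
by rewrite cats0; apply: (@run_one _ _ rend MRight); rewrite //= eqxx.
Qed.

Definition TM_of (F : frag sym) : TM :=
  {| tm_state := (fstate F + bool)%type; tm_sym := sym; tm_blank := blankS; tm_inp := bitS label K;
     tm_start := inl (f0 F); tm_acc := inr true; tm_rej := inr false;
     tm_delta := fun q s => match q with inl q' =>
        let: (x, g, mv) := fd q' s in (match x with inl q1 => inl q1 | inr b => inr b end, g, mv)
        | inr b => (inr b, s, MStay) end |}.

Definition cfg_of F (q : tm_state (TM_of F)) (t : tape sym) : cfg (TM_of F) := @Cfg (TM_of F) q t.1.1 t.1.2 t.2.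

Lemma cfg_of_step F q q' t g mv : fd q t.1.2 = (q', g, mv) ->
  tm_step (@cfg_of F (inl q) t) = cfg_of (match q' with inl q1 => inl q1 | inr b => inr b end) (wm blankS g mv t).
Proof.
case: t => [[l h] r] /= Hd; rewrite /tm_step /= Hd; case: mv {Hd} => //.
- by case: l.
- by case: r.
Qed.

Lemma run_TM F q t n b t' : @runS F q t n b t' ->
  iter n (@tm_step (TM_of F)) (cfg_of (inl q) t) = cfg_of (inr b) t'.
Proof.
elim=> {q t n b t'} [q l h r b g mv Hd|q l h r q' g mv n b t' Hd _ IH].
- by rewrite /= (cfg_of_step (t := (l, h, r)) Hd).
- by rewrite iterSr (cfg_of_step (t := (l, h, r)) Hd).
Qed.

Lemma read_bits_bits F o : @read_bits (TM_of F) (map (bitS label K) o) = o.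
Proof. by elim: o => //= -[] o ->. Qed.

Theorem prog_poly_time (p : prog label K) : ok set0 p ->
  poly_time_computable (fun w => eval (None, false) (labels w) [ffun=> size (labels w)] p).
Proof.
move=> Hok; have [g [c [d Hg]] HT] := time_poly p.
(* The factor [3 ^ d.+1] passes from the number of positions, [size w + 1] or 2 on the empty input,
   to [size w]; the 30 covers the linear cost of [fInit] and [fEnd]. *)
exists (TM_of (fSeq fInit (fSeq (compile p) fEnd))), ((c + 30) * 3 ^ d.+1), d.+1 => w.
have Hact : active (labels w) set0 [ffun k : K => size (labels w)] by move=> k; rewrite inE ffunE.
have Hv : 0 < size (labels w) by rewrite size_labels.
have [t1 Ht1 Hr1] := run_fInit w.
have [t2 Ht2 Hr2] := run_compile (None, false) [::] Hv Hok Hact.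
have Hr3 := run_fEnd (cells (None, false) (labels w) [ffun k : K => size (labels w)])
   (eval (None, false) (labels w) [ffun k : K => size (labels w)] p).
rewrite size_cells in Hr3; rewrite -cells_labels in Hr1.
have := run_TM (run_fSeq Hr1 (run_fSeq Hr2 Hr3)).
set n := _ + _; set t := mkt _ _ _ => Hrun.
have Hinit : tm_run (TM_of (fSeq fInit (fSeq (compile p) fEnd))) w n = cfg_of (inr true) t.
  by rewrite -Hrun /tm_run; congr iter; case: (w).
exists n; rewrite Hinit; split; last split=> //.
- rewrite /n size_labels; rewrite size_labels in Ht2.
  have {}Ht2 := leq_trans Ht2 (HT (size w).-1.+2 0 (ltn0Sn _)); rewrite muln1 in Ht2.
  have {}Ht2 := leq_trans Ht2 (Hg (size w).-1.+2 (ltn0Sn _)).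
  have Hbound : (size w).-1.+2 ^ d.+1 <= 3 ^ d.+1 * size w ^ d.+1 + 3 ^ d.+1.
    case: (size w) => [|m]; first by rewrite exp0n // muln0 add0n leq_exp2r.
    by rewrite -expnMn; apply: leq_trans (leq_addr _ _); rewrite leq_exp2r //=; lia.
  have H1 : (size w).-1.+2 ^ d <= (size w).-1.+2 ^ d.+1 by rewrite leq_exp2l.
  have H2 : size w <= (size w).-1.+2 ^ d.+1.
    by apply: (@leq_trans (size w).-1.+2); [lia|rewrite -{1}(expn1 (size w).-1.+2) leq_exp2l].
  have H3 : 0 < (size w).-1.+2 ^ d.+1 by rewrite expn_gt0.
  have H4 : c * (size w).-1.+2 ^ d <= c * (size w).-1.+2 ^ d.+1 by rewrite leq_mul2l H1 orbT.
  apply: (@leq_trans ((c + 30) * (size w).-1.+2 ^ d.+1)).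
    rewrite mulnDl; move: H2 H3 H4 Ht1 Ht2.
    move: (c * (size w).-1.+2 ^ d.+1) (c * (size w).-1.+2 ^ d) ((size w).-1.+2 ^ d.+1) => a b e.
    by lia.
  by rewrite -mulnA -mulnDr leq_mul2l; apply/orP; right; apply: leq_trans Hbound _; rewrite mulnC.
- rewrite /tm_output /t; move: (eval _ _ _ _) => o.
  by case: o => [|b o] //=; case: b; rewrite read_bits_bits.
Qed.

End Machine.

(** * Loops over tuples of positions *)

Definition rep (n : nat) (u : seq bool) : seq bool := flatten (nseq n u).

Lemma rep_add a b u : rep (a + b) u = rep a u ++ rep b u.
Proof. by rewrite /rep nseqD flatten_cat. Qed.

Lemma repS_r n u : rep n.+1 u = rep n u ++ u.
Proof. by rewrite -addn1 rep_add /rep /= cats0. Qed.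

Lemma rep_rep a b u : rep a (rep b u) = rep (a * b) u.
Proof. by elim: a => // a IH; rewrite mulSn rep_add -IH. Qed.

Lemma rep_nil n : rep n [::] = [::].
Proof. by elim: n. Qed.

Lemma flatten_const (T : Type) (l : seq T) u : flatten [seq u | _ <- l] = rep (size l) u.
Proof. by elim: l => //= _ l ->. Qed.

(** How a loop prints as many copies as the value of a tuple: one for each smaller value. *)
Lemma flatten_lt n c u : c <= n -> flatten [seq (if i < c then u else [::]) | i <- iota 0 n] = rep c u.
Proof.
move=> Hc; rewrite -(subnKC Hc) iotaD map_cat flatten_cat add0n.
rewrite (_ : [seq _ | i <- iota 0 c] = [seq u | _ <- iota 0 c]); last first.
  by apply/eq_in_map => i; rewrite mem_iota add0n => /andP [_ ->].
rewrite (_ : [seq _ | i <- iota c _] = [seq [::] | _ <- iota c (n - c)]); last first.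
  by apply/eq_in_map => i; rewrite mem_iota => /andP [H _]; rewrite ltnNge H.
by rewrite !flatten_const rep_nil cats0 size_iota.
Qed.

(** Counting larger values gives the level number, as levels are printed from the outermost one
    inwards. *)
Lemma flatten_gt n c u : c < n -> flatten [seq (if c < i then u else [::]) | i <- iota 0 n] = rep (n.-1 - c) u.
Proof.
move=> Hc; rewrite (_ : n = c.+1 + (n.-1 - c)); last by lia.
rewrite iotaD map_cat flatten_cat add0n.
rewrite (_ : [seq _ | i <- iota 0 _] = [seq [::] | _ <- iota 0 c.+1]); last first.
  by apply/eq_in_map => i; rewrite mem_iota => /andP [_]; rewrite add0n ltnS => H; rewrite ltnNge H.
rewrite (_ : [seq _ | i <- iota c.+1 _] = [seq u | _ <- iota c.+1 (n.-1 - c)]); last first.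
  by apply/eq_in_map => i; rewrite mem_iota => /andP [-> _].
by rewrite !flatten_const rep_nil size_iota; congr rep; lia.
Qed.

(** Leaving out 0 gives the predecessor, for the left neighbour of a cell. *)
Lemma flatten_lt_pred n c u : c <= n ->
  flatten [seq (if i == 0 then [::] else if i < c then u else [::]) | i <- iota 0 n] = rep c.-1 u.
Proof.
case: n => [|n]; first by case: c.
move=> Hc /=; rewrite -[1]/(1 + 0) iotaDl -map_comp -(@flatten_lt n c.-1); last by lia.
by congr flatten; apply/eq_map => i /=; congr (if _ then _ else _); lia.
Qed.

(** * Tuples of loop variables as numbers *)

Section BigFor.
Variables (lab K : finType) (l0 : lab) (v : seq lab).
Notation prog := (prog lab K).
Notation N := (size v).

Definition BigFor (xs : seq K) (p : prog) : prog := foldr (@For lab K) p xs.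

(* Tuples of positions are read as numbers in base [N], most significant digit first. *)
Definition val_from (e : env K) (a : nat) (xs : seq K) : nat := foldl (fun b x => b * N + e x) a xs.

Definition at_ (xs : seq K) (i : nat) (e : env K) : Prop :=
  all (fun x => e x < N) xs /\ val_from e 0 xs = i.

Definition agree (xs : seq K) (e e' : env K) : Prop := forall k, k \notin xs -> e' k = e k.

Lemma at_agree xs ys i (e e' : env K) : agree xs e e' -> ~~ has (mem xs) ys -> at_ ys i e -> at_ ys i e'.
Proof.
move=> Ha Hd [H <-]; split.
- by apply/allP => y Hy; rewrite Ha; [exact: (allP H)|apply: (hasPn Hd)].
- rewrite /val_from; elim: ys 0 Hd {H} => //= y ys IH a; rewrite negb_or => /andP [Hy Hd].
  by rewrite Ha // IH.
Qed.

(** The leading digits [a] confine the number to an interval of length [N ^ size xs]. As these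
    intervals are disjoint for different [a], comparison is lexicographic. *)
Lemma val_bounds (e : env K) a xs : all (fun x => e x < N) xs ->
  a * N ^ size xs <= val_from e a xs < a.+1 * N ^ size xs.
Proof.
elim: xs a => [|x xs IH] a /=; first by rewrite !muln1 leqnn ltnSn.
move=> /andP [Hx Hxs]; have := IH (a * N + e x) Hxs; rewrite /val_from /= expnS => /andP [H1 H2].
apply/andP; split.
- by apply: leq_trans H1; rewrite mulnA leq_mul2r leq_addr orbT.
- apply: leq_trans H2 _; rewrite mulnA leq_mul2r; apply/orP; right; rewrite mulSn; lia.
Qed.

Lemma flatten_blocks (G : nat -> seq bool) b n m :
  flatten [seq flatten [seq G j | j <- iota (b + i * m) m] | i <- iota 0 n] =
  flatten [seq G j | j <- iota b (n * m)].
Proof.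
elim: n => // n IH; rewrite -[X in iota 0 X]addn1 iotaD map_cat flatten_cat IH add0n /= cats0.
by rewrite mulSnr iotaD map_cat flatten_cat.
Qed.

Lemma eval_BigFor xs p e (G : nat -> seq bool) : uniq xs ->
  (forall e' i, agree xs e e' -> at_ xs i e' -> i < N ^ size xs -> eval l0 v e' p = G i) ->
  eval l0 v e (BigFor xs p) = flatten [seq G i | i <- iota 0 (N ^ size xs)].
Proof.
(* Generalised to the variables [ys] still to be fixed and the value [a] of the digits before
   them. *)
move=> Hu H; suff Hg ys a e1 : uniq ys ->
    (forall e', agree ys e1 e' -> all (fun x => e' x < N) ys -> eval l0 v e' p = G (val_from e' a ys)) ->
    eval l0 v e1 (BigFor ys p) = flatten [seq G i | i <- iota (a * N ^ size ys) (N ^ size ys)].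
  rewrite (Hg xs 0) //.
  move=> e' He' Hall; apply: (H _ _ He' (conj Hall erefl)).
  by have := val_bounds 0 Hall; rewrite mul1n => /andP [].
elim: ys a e1 => [|y ys IH] a e1 /=.
  by move=> _ H1; rewrite muln1 cats0; apply: H1.
move=> /andP [Hy Hys] H1.
rewrite (_ : [seq _ | i <- iota 0 N] =
   [seq flatten [seq G j | j <- iota (a * N ^ (size ys).+1 + i * N ^ size ys) (N ^ size ys)] | i <- iota 0 N]).
  by rewrite flatten_blocks -expnS.
apply/eq_in_map => i; rewrite mem_iota => Hi.
rewrite (IH (a * N + i)) //; first by rewrite mulnDl -mulnA -expnS.
move=> e' He' Hall.
have Ey : e' y = i by rewrite He' // ffunE eqxx.
rewrite H1 /val_from /= ?Ey //; last by rewrite Hall andbT.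
move=> k; rewrite inE negb_or => /andP [Hk1 Hk2].
by rewrite He' // ffunE (negPf Hk1).
Qed.

Fixpoint IfLt (xs ys : seq K) (p q : prog) : prog :=
  match xs, ys with
  | x :: xs', y :: ys' => If (TLt lab x y) p (If (TLt lab y x) q (IfLt xs' ys' p q))
  | _, _ => q
  end.

Lemma eval_IfLt xs ys i j e p q : size xs = size ys -> at_ xs i e -> at_ ys j e ->
  eval l0 v e (IfLt xs ys p q) = if i < j then eval l0 v e p else eval l0 v e q.
Proof.
move=> Hs [Hx <-] [Hy <-]; move: {1 2}0 => a.
elim: xs ys a Hs Hx Hy => [|x xs IH] [|y ys] a //= => [_ _ _|[Hs] /andP [Hx Hxs] /andP [Hy Hys]].
  by rewrite ltnn.
have Bx := val_bounds (a * N + e x) Hxs; have By := val_bounds (a * N + e y) Hys.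
rewrite /val_from /= in Bx By *; rewrite Hs in Bx.
case: (ltngtP (e x) (e y)) => Hxy.
- rewrite (_ : _ < _); first by [].
  case/andP: Bx => _ Bx; case/andP: By => By _; apply: leq_trans Bx (leq_trans _ By).
  by rewrite leq_mul2r; apply/orP; right; lia.
- rewrite (_ : _ < _ = false); first by [].
  case/andP: Bx => Bx _; case/andP: By => _ By; apply/negbTE; rewrite -leqNgt.
  apply: leq_trans (ltnW By) (leq_trans _ Bx).
  by rewrite leq_mul2r; apply/orP; right; lia.
- by rewrite Hxy; apply: IH.
Qed.

Definition IfAll (P : pred lab) (xs : seq K) (p q : prog) : prog :=
  foldr (fun x r => If (TLab x P) r q) p xs.

Lemma eval_IfAll P xs e p q : eval l0 v e (IfAll P xs p q) =
  if all (fun x => P (nth l0 v (e x))) xs then eval l0 v e p else eval l0 v e q.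
Proof. by elim: xs => //= x xs ->; case: (P _). Qed.

Lemma val_zero xs i (e : env K) : 0 < N -> at_ xs i e -> all (fun x => e x == 0) xs = (i == 0).
Proof.
move=> HN [Hall <-].
suff H a : (val_from e a xs == 0) = (a == 0) && all (fun x => e x == 0) xs by rewrite H.
elim: xs a Hall => [|x xs IH] a /=; first by rewrite andbT.
move=> /andP [Hx Hxs]; rewrite /val_from /= -/(val_from _ _ _) IH //.
by rewrite addn_eq0 muln_eq0 (gtn_eqF HN) orbF andbA.
Qed.

Lemma val_last xs i (e : env K) : 0 < N -> at_ xs i e ->
  all (fun x => e x == N.-1) xs = (i == (N ^ size xs).-1).
Proof.
move=> HN [Hall <-].
suff H a n : a <= n -> (val_from e a xs == (n.+1 * N ^ size xs).-1) = (a == n) && all (fun x => e x == N.-1) xs.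
  by rewrite -[N ^ size xs]mul1n H.
elim: xs a n Hall => [|x xs IH] a n /=; first by rewrite andbT muln1.
move=> /andP [Hx Hxs] Han; rewrite /val_from /= -/(val_from _ _ _).
have -> : n.+1 * N ^ (size xs).+1 = (n * N + N.-1).+1 * N ^ size xs.
  by rewrite expnS mulnA; congr (_ * _); rewrite mulSn; lia.
rewrite IH //; last by apply: leq_add; [rewrite leq_mul2r Han orbT|lia].
rewrite andbA; congr (_ && _); apply/eqP/andP => [H|[/eqP -> /eqP ->] //].
have [Ea|Hne] := eqVneq a n; first by split=> //; apply/eqP; move: H; rewrite Ea; lia.
by have : a.+1 * N <= n * N; [rewrite leq_mul2r; lia|rewrite mulSn; lia].
Qed.

Definition pCat (l : seq prog) : prog := foldr (@Seq lab K) (Out lab K [::]) l.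

Lemma eval_pCat l e : eval l0 v e (pCat l) = flatten (map (eval l0 v e) l).
Proof. by elim: l => //= p l ->. Qed.

Lemma ok_BigFor (A : {set K}) xs p : uniq xs -> (forall x, x \in xs -> x \notin A) ->
  (forall B : {set K}, (forall k, (k \in B) = (k \in xs) || (k \in A)) -> ok B p) -> ok A (BigFor xs p).
Proof.
elim: xs A => [|x xs IH] A /=; first by move=> _ _; apply.
move=> /andP [Hx Hxs] HA HB; rewrite HA ?mem_head //=; apply: IH => // [y Hy|B HBk].
- rewrite !inE negb_or HA ?inE ?Hy ?orbT // andbT; apply: contraNneq Hx => <- //.
- by apply: HB => k; rewrite HBk !inE orbCA orbA.
Qed.

Lemma ok_IfLt (A : {set K}) xs ys p q : {subset xs <= A} -> {subset ys <= A} -> ok A p -> ok A q ->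
  ok A (IfLt xs ys p q).
Proof.
elim: xs ys => [|x xs IH] [|y ys] //= Hx Hy Hp Hq.
have Ax : x \in A by apply/Hx/mem_head.
have Ay : y \in A by apply/Hy/mem_head.
rewrite Ax Ay Hp Hq /=; apply: IH => // z Hz; [apply: Hx|apply: Hy]; by rewrite inE Hz orbT.
Qed.

Lemma ok_IfAll (A : {set K}) P xs p q : {subset xs <= A} -> ok A p -> ok A q -> ok A (IfAll P xs p q).
Proof.
elim: xs => [|x xs IH] //= Hx Hp Hq; have Ax : x \in A by apply/Hx/mem_head.
rewrite Ax Hq andbT /=.
by apply: IH => // z Hz; apply: Hx; rewrite inE Hz orbT.
Qed.

Lemma ok_pCat (A : {set K}) (T : eqType) (f : T -> prog) (l : seq T) :
  (forall x, x \in l -> ok A (f x)) -> ok A (pCat (map f l)).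
Proof.
elim: l => //= x l IH H; rewrite H ?mem_head //=; apply: IH => y Hy; apply: H; by rewrite inE Hy orbT.
Qed.

End BigFor.

(** * The program printing the formula *)

Definition pre_track : seq bool :=
  [:: false; true; true; true; false; false; false; true; true; false; true; false] ++
  enc_ctl (CNeg (CAnd (CNeg (CAtom Lt)) (CNeg (CAtom Ltb)))).
Definition post_track : seq bool := enc_ctl q0_dead.

(** In prefix notation the nested context becomes one string repeated on each side of the core, so
    [k] appears only as a number of copies. *)
Lemma enc_div_ctl k : enc_ctl (div_ctl k) =
  rep k pre_track ++ enc_ctl even_base ++ rep k post_track.
Proof.
elim: k => [|k IH]; first by rewrite cats0.
rewrite /div_ctl iterS -/(div_ctl k) [rep k.+1 post_track]repS_r.
have -> : rep k.+1 pre_track = pre_track ++ rep k pre_track by [].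
have -> : enc_ctl (CEX (countdown (div_ctl k))) = pre_track ++ enc_ctl (div_ctl k) ++ post_track by [].
by rewrite IH -!catA.
Qed.

(** The three bits dropped from [pre_track] are the tag of its outer [CEX]; what remains opens
    [countdown]. *)
Definition pre_bit : seq bool :=
  [:: false; true; true; false; true; false] ++
  enc_ctl (CNeg (CAnd (CNeg (CAtom Lq1)) (CNeg (CAtom Lq2)))) ++ behead (behead (behead pre_track)).

Lemma enc_bit_ctl k : enc_ctl (bit_ctl k) = pre_bit ++ enc_ctl (div_ctl k) ++ post_track.
Proof. by []. Qed.

Definition pre_ex : seq bool :=
  [:: false; true; true; true; false; false; false; false; true; false; true; false] ++
  enc_ctl (CNeg (CAtom Lp0)) ++
  [:: false; false; true; false; true; true; false; true; false] ++ enc_ctl (CAtom Ltb).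
Definition mid_ex : seq bool :=
  [:: false; true; false] ++ enc_ctl (CAtom Ltb) ++ [:: false; true; false; false; false; true].

Lemma enc_ex_ctl hi lo X : enc_ctl (ex_ctl hi lo X) =
  pre_ex ++ enc_ctl (div_ctl hi) ++ mid_ex ++ enc_ctl (div_ctl lo) ++ enc_ctl X.
Proof. by []. Qed.

Definition and_tag : seq bool := [:: false; true; false].
Definition neg_tag : seq bool := [:: false; false; true].

Lemma enc_neg X : enc_ctl (CNeg X) = neg_tag ++ enc_ctl X.
Proof. by []. Qed.

Lemma enc_and X Y : enc_ctl (CAnd X Y) = and_tag ++ enc_ctl X ++ enc_ctl Y.
Proof. by []. Qed.

(** A conjunction without its closing atom; in this form concatenation of lists becomes
    concatenation of texts, which loops can produce. *)
Definition enc_items (l : seq ctl) : seq bool := flatten [seq and_tag ++ enc_ctl x | x <- l].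

Lemma enc_conj l : enc_ctl (conj_ctl l) = enc_items l ++ enc_ctl (CAtom Ltb).
Proof. by elim: l => // x l IH; rewrite /= IH /enc_items /= -!catA. Qed.

Lemma enc_items_flatten (T : Type) (F : T -> seq ctl) l :
  enc_items (flatten (map F l)) = flatten [seq enc_items (F x) | x <- l].
Proof.
by elim: l => //= x l IH; rewrite /enc_items map_cat flatten_cat -/(enc_items _) -/(enc_items _) IH.
Qed.

Lemma enc_items_map (T : Type) (F : T -> ctl) l :
  enc_items (map F l) = flatten [seq and_tag ++ enc_ctl (F x) | x <- l].
Proof. by rewrite /enc_items -map_comp. Qed.

Lemma labels_fst w : map fst (labels w) = [:: None, Some (inr (ohead w)) & [seq Some (inl b) | b <- behead w]].
Proof. by rewrite /= map_rcons -map_comp map_id -lastI. Qed.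

Lemma labels_none w i : i < size (labels w) -> (nth (None, false) (labels w) i).1 = None <-> i = 0.
Proof.
move=> Hi; rewrite -(nth_map _ None) // labels_fst; case: i Hi => [|[|i]] //=.
rewrite size_rcons size_map size_belast size_map => Hi.
by rewrite (nth_map false) //; lia.
Qed.

Definition is_head (x : label) : bool := if x.1 is Some (inr _) then true else false.

Lemma labels_head w i : i < size (labels w) -> is_head (nth (None, false) (labels w) i) = (i == 1).
Proof.
rewrite /is_head => Hi; rewrite -(nth_map _ None) // labels_fst; move: Hi; rewrite size_labels.
case: i => [|[|i]] // Hi; rewrite /= (nth_map false) // size_behead; lia.
Qed.

Lemma labels_last w i : i < size (labels w) -> (nth (None, false) (labels w) i).2 = (i == (size (labels w)).-1).
Proof.
rewrite size_labels; case: i => [|i] //= Hi.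
rewrite nth_rcons size_map size_belast size_map size_behead.
case: ltngtP => H; rewrite ?eqSS; [|lia|].
- rewrite (nth_map None) /= ?size_belast ?size_map ?size_behead //; lia.
- by rewrite H eqxx.
Qed.

Lemma enc_items1 x : enc_items [:: x] = and_tag ++ enc_ctl x.
Proof. by rewrite /enc_items /= cats0. Qed.

Lemma enc_items2 x y : enc_items [:: x; y] = (and_tag ++ enc_ctl x) ++ (and_tag ++ enc_ctl y).
Proof. by rewrite /enc_items /= cats0. Qed.

Section Generator.
Variables (K : finType) (sg bl : nat) (delta : nat -> nat -> nat -> nat) (bad : nat -> bool).
(** The tuples [lam] and [cel] hold the current level and cell; [lam'] and [cel'] run through all
    values in order to count relative to them. *)
Variables (lam lam' cel cel' : seq K) (c1 : K) (cmid : seq K) (cl : K).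
Hypothesis celE : cel = c1 :: rcons cmid cl.
Hypothesis marks_uniq : uniq (lam ++ lam' ++ cel ++ cel').

Notation prog := (prog label K).
Notation Out := (@Out label K).

Definition is_first (x : label) : bool := ~~ isSome x.1.
Definition is_last (x : label) : bool := x.2.

Implicit Type A : seq bool -> prog.

(** Here [A u] prints [u] as often as the index says. Taking [u] as an argument lets the opening and
    the closing string share the same count. *)
Definition pDiv A : prog := Seq (A pre_track) (Seq (Out (enc_ctl even_base)) (A post_track)).
Definition pBit A : prog := Seq (Out pre_bit) (Seq (pDiv A) (Out post_track)).
Definition pEx A A' : prog := Seq (Out pre_ex) (Seq (pDiv A) (Seq (Out mid_ex) (pDiv A'))).

(* [aTop], [aLevel], [aZero] emit the offset [3 l W] of level [l], where [l] is the number of values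
   of [lam], the number of values above the current one, and 0, respectively. *)
Definition aTop : seq bool -> prog := fun u => BigFor lam' (BigFor cel' (Out (rep (3 * sg) u))).
Definition aLevel : seq bool -> prog :=
  fun u => BigFor lam' (IfLt lam lam' (BigFor cel' (Out (rep (3 * sg) u))) (Out [::])).
Definition aZero : seq bool -> prog := fun _ => Out [::].
(** The summands of an index are printed one after another: [r * W] by a loop over all cells, in
    [aCell] then [c * sg] by a loop over the cells before [c], and [s] as a constant. *)
Definition aBlock (base : seq bool -> prog) (r : nat) : seq bool -> prog :=
  fun u => Seq (base u) (BigFor cel' (Out (rep (r * sg) u))).
Definition aCell (base : seq bool -> prog) (r s : nat) : seq bool -> prog :=
  fun u => Seq (aBlock base r u) (Seq (BigFor cel' (IfLt cel' cel (Out (rep sg u)) (Out [::]))) (Out (rep s u))).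
Definition aPrev (base : seq bool -> prog) (r s : nat) : seq bool -> prog :=
  fun u => Seq (aBlock base r u)
    (Seq (BigFor cel' (IfAll is_first cel' (Out [::]) (IfLt cel' cel (Out (rep sg u)) (Out [::])))) (Out (rep s u))).

Definition pImp A A' : prog :=
  Seq (Out (neg_tag ++ and_tag)) (Seq (pBit A) (Seq (Out neg_tag) (pBit A'))).

Definition pIncl (a b a' b' : nat) : prog :=
  Seq (BigFor cel (pCat [seq Seq (Seq (Out and_tag) (pImp (aCell aLevel a s) (aCell aLevel b s)))
                                 (Seq (Out and_tag) (pImp (aCell aLevel a' s) (aCell aLevel b' s)))
                        | s <- iota 0 sg]))
      (Out (enc_ctl (CAtom Ltb))).

Definition pLevel : prog :=
  Seq (pEx (aBlock aLevel 3) (aBlock aLevel 2))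
 (Seq (Out neg_tag)
 (Seq (pEx (aBlock aLevel 2) (aBlock aLevel 1))
 (Seq (pEx (aBlock aLevel 1) (aBlock aLevel 0))
 (Seq (Out (and_tag ++ neg_tag ++ and_tag ++ neg_tag))
 (Seq (pIncl 1 4 2 0)
 (Seq (Out neg_tag)
 (Seq (pIncl 1 2 3 0)
      (Out neg_tag)))))))).

Definition pRule (a b d : nat) : prog :=
  Seq (Out (and_tag ++ neg_tag ++ and_tag))
 (Seq (pBit (aPrev aZero 1 a))
 (Seq (Out and_tag)
 (Seq (pBit (aCell aZero 1 b))
 (Seq (Out and_tag)
 (Seq (pBit (aCell aZero 1 (sg + d)))
 (Seq (Out neg_tag)
      (pBit (aCell aZero 0 (delta a b d))))))))).

Definition pStep : prog :=
  let border := Seq (Out and_tag) (pBit (aCell aZero 0 bl)) in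
  Seq (BigFor cel (IfAll is_first cel border (IfAll is_last cel border
        (pCat [seq pCat [seq pCat [seq pRule a b d | d <- iota 0 sg] | b <- iota 0 sg] | a <- iota 0 sg]))))
      (Out (enc_ctl (CAtom Ltb))).

Variables (s_head : option bool -> nat) (s_inp : bool -> nat).

(** [is_head] recognises the digit 1 and [is_first] the digit 0. If the index is 1 followed by zeros
    up to its last digit, that digit names a position whose label gives the symbol. *)
Definition pInitCell (body : nat -> prog) : prog :=
  IfAll is_head [:: c1]
    (IfAll is_first cmid
      (IfAll (fun x => x.1 == Some (inr None)) [:: cl] (body (s_head None))
      (IfAll (fun x => x.1 == Some (inr (Some true))) [:: cl] (body (s_head (Some true)))
      (IfAll (fun x => x.1 == Some (inr (Some false))) [:: cl] (body (s_head (Some false)))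
      (IfAll (fun x => x.1 == Some (inl true)) [:: cl] (body (s_inp true))
      (IfAll (fun x => x.1 == Some (inl false)) [:: cl] (body (s_inp false)) (body bl))))))
      (body bl))
    (body bl).

Definition pInit : prog :=
  Seq (BigFor cel (pInitCell (fun s => Seq (Out and_tag) (pBit (aCell aTop 1 s))))) (Out (enc_ctl (CAtom Ltb))).

Definition pFinal : prog :=
  Seq (BigFor cel (pCat [seq Seq (Out (and_tag ++ neg_tag)) (pBit (aCell aTop 0 s)) | s <- iota 0 sg & bad s]))
      (Out (enc_ctl (CAtom Ltb))).

Definition pAccept : prog :=
  Seq (Out (enc_unary (loc_code Ltb) ++ enc_nat 0))
 (Seq (pEx (aBlock aTop 2) (aBlock aTop 1))
 (Seq (Out and_tag)
 (Seq pInit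
 (Seq (pEx (aBlock aTop 1) (aBlock aTop 0))
 (Seq (Out and_tag)
 (Seq pFinal
 (Seq (BigFor lam pLevel)
      pStep))))))).

(** * Well-formedness: no loop reuses an active variable *)

Let disjointness : [/\ uniq lam, uniq lam', uniq cel & uniq cel'] /\
  [/\ ~~ has (mem lam') lam, ~~ has (mem cel') lam, ~~ has (mem cel) lam,
      ~~ has (mem lam') cel & ~~ has (mem cel') cel].
Proof.
move: marks_uniq; rewrite !cat_uniq !has_cat !negb_or.
move=> /and3P [U1 /and3P [D1 D2 D3] /and3P [U2 /andP [D4 D5] /and3P [U3 D6 U4]]].
by split; split=> //; rewrite has_sym.
Qed.

Definition okA (B : {set K}) A : Prop := forall u, ok B (A u).

Lemma ok_pBit B A : okA B A -> ok B (pBit A).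
Proof. by move=> H; rewrite /= !H. Qed.

Lemma ok_pEx B A A' : okA B A -> okA B A' -> ok B (pEx A A').
Proof. by move=> H H'; rewrite /= !H !H'. Qed.

Definition fresh (B : {set K}) : Prop := forall x, (x \in lam') || (x \in cel') -> x \notin B.

Lemma cel'_notin x : x \in cel' -> x \notin lam'.
Proof.
move: marks_uniq; rewrite !cat_uniq !has_cat !negb_or.
by move=> /and3P [_ _ /and3P [_ /andP [_ /hasPn H] _]] /H.
Qed.

Lemma ok_top (B : {set K}) : fresh B -> okA B aTop.
Proof.
move=> HB u; have [[_ Ul' _ Uc'] _] := disjointness.
apply: ok_BigFor => // [x Hx|B' HB']; first by apply: HB; rewrite Hx.
apply: ok_BigFor => // x Hx; rewrite HB' negb_or HB ?Hx ?orbT // andbT.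
exact: cel'_notin.
Qed.

Lemma ok_level (B : {set K}) : fresh B -> {subset lam <= B} -> okA B aLevel.
Proof.
move=> HB Hl u; have [[_ Ul' _ Uc'] _] := disjointness.
apply: ok_BigFor => // [x Hx|B' HB']; first by apply: HB; rewrite Hx.
apply: ok_IfLt => // [x Hx|x Hx|]; first by rewrite HB' (Hl _ Hx) orbT.
  by rewrite HB' Hx.
apply: ok_BigFor => // x Hx; rewrite HB' negb_or HB ?Hx ?orbT // andbT.
exact: cel'_notin.
Qed.

Lemma ok_block (B : {set K}) base r : fresh B -> okA B base -> okA B (aBlock base r).
Proof.
move=> HB H u; have [[_ _ _ Uc'] _] := disjointness.
by rewrite /= H; apply: ok_BigFor => // x Hx; apply: HB; rewrite Hx orbT.
Qed.

Lemma ok_cell (B : {set K}) base r s : fresh B -> okA B base -> {subset cel <= B} -> okA B (aCell base r s).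
Proof.
move=> HB H Hc u; have [[_ _ _ Uc'] _] := disjointness.
have := ok_block r HB H u; rewrite /= => -> /=; rewrite andbT.
apply: ok_BigFor => // [x Hx|B' HB']; first by apply: HB; rewrite Hx orbT.
by apply: ok_IfLt => // x Hx; rewrite HB' ?Hx // (Hc _ Hx) orbT.
Qed.

Lemma ok_prev (B : {set K}) base r s : fresh B -> okA B base -> {subset cel <= B} -> okA B (aPrev base r s).
Proof.
move=> HB H Hc u; have [[_ _ _ Uc'] _] := disjointness.
have := ok_block r HB H u; rewrite /= => -> /=; rewrite andbT.
apply: ok_BigFor => // [x Hx|B' HB']; first by apply: HB; rewrite Hx orbT.
apply: ok_IfAll => // [x Hx|]; first by rewrite HB' Hx.
by apply: ok_IfLt => // x Hx; rewrite HB' ?Hx // (Hc _ Hx) orbT.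
Qed.

Lemma fresh_cel (B B' : {set K}) : fresh B -> (forall k, (k \in B') = (k \in cel) || (k \in B)) ->
  fresh B' /\ {subset cel <= B'}.
Proof.
have [_ [_ _ _ /hasPn D4 /hasPn D5]] := disjointness.
move=> HB HB'; split=> x Hx; rewrite HB' ?Hx // negb_or HB // andbT.
apply/negP => Hc; have := D4 x Hc; have := D5 x Hc; rewrite !inE.
by case/orP: Hx => ->.
Qed.

Lemma ok_pLevel (B : {set K}) : fresh B -> {subset lam <= B} -> (forall x, x \in cel -> x \notin B) -> ok B pLevel.
Proof.
move=> HB Hl Hc; have [[_ _ Uc _] _] := disjointness.
have HA := ok_level HB Hl; have HBk r := ok_block r HB HA.
have Hincl a b a' b' : ok B (pIncl a b a' b').
  rewrite /pIncl /= andbT; apply: ok_BigFor => // B' HB'; have [Hf Hcel] := fresh_cel HB HB'.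
  apply: ok_pCat => s _; have HA' : okA B' aLevel by apply: ok_level => // x Hx; rewrite HB' Hl ?orbT.
  have Hbit r : ok B' (pBit (aCell aLevel r s)) by apply/ok_pBit/ok_cell.
  rewrite -[ok _ _]/((true && (true && (ok B' (pBit (aCell aLevel a s)) && (true && ok B' (pBit (aCell aLevel b s)))))) &&
    (true && (true && (ok B' (pBit (aCell aLevel a' s)) && (true && ok B' (pBit (aCell aLevel b' s))))))).
  by rewrite !Hbit.
have Hex r r' : ok B (pEx (aBlock aLevel r) (aBlock aLevel r')) by apply: ok_pEx.
rewrite -[ok _ _]/(ok B (pEx (aBlock aLevel 3) (aBlock aLevel 2)) && (true &&
  (ok B (pEx (aBlock aLevel 2) (aBlock aLevel 1)) && (ok B (pEx (aBlock aLevel 1) (aBlock aLevel 0)) &&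
  (true && (ok B (pIncl 1 4 2 0) && (true && (ok B (pIncl 1 2 3 0) && true)))))))).
by rewrite !Hex !Hincl.
Qed.

Lemma ok_pStep : ok set0 pStep.
Proof.
have [[_ _ Uc _] _] := disjointness.
have HB : fresh set0 by move=> x _; rewrite inE.
rewrite /pStep /= andbT; apply: ok_BigFor => // [x|B HB']; first by rewrite inE.
have [Hf Hcel] := fresh_cel HB HB'.
have Hz : okA B aZero by [].
have Hcellp r s : ok B (pBit (aCell aZero r s)) by apply/ok_pBit/ok_cell.
have Hbord : ok B (Seq (Out and_tag) (pBit (aCell aZero 0 bl))) by exact: Hcellp.
apply: ok_IfAll => //; apply: ok_IfAll => //; apply: ok_pCat => a _; apply: ok_pCat => b _; apply: ok_pCat => d _.
have Hp : ok B (pBit (aPrev aZero 1 a)) by apply/ok_pBit/ok_prev.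
rewrite -[ok _ _]/(true && (ok B (pBit (aPrev aZero 1 a)) && (true && (ok B (pBit (aCell aZero 1 b)) && (true &&
  (ok B (pBit (aCell aZero 1 (sg + d))) && (true && ok B (pBit (aCell aZero 0 (delta a b d)))))))))).
by rewrite Hp !Hcellp.
Qed.

Lemma ok_pInit : ok set0 pInit.
Proof.
have [[_ _ Uc _] _] := disjointness.
have HB : fresh set0 by move=> x _; rewrite inE.
rewrite /pInit /= andbT; apply: ok_BigFor => // [x|B HB']; first by rewrite inE.
have [Hf Hcel] := fresh_cel HB HB'.
have Hcellp s : ok B (Seq (Out and_tag) (pBit (aCell aTop 1 s))) by exact: (ok_pBit (ok_cell 1 s Hf (ok_top Hf) Hcel)).
have Hc1 : {subset [:: c1] <= B} by move=> x; rewrite inE => /eqP ->; apply: Hcel; rewrite celE mem_head.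
have Hcl : {subset [:: cl] <= B}.
  by move=> x; rewrite inE => /eqP ->; apply: Hcel; rewrite celE inE mem_rcons mem_head orbT.
have Hcm : {subset cmid <= B} by move=> x Hx; apply: Hcel; rewrite celE inE mem_rcons inE Hx !orbT.
by rewrite /pInitCell; do 7 (apply: ok_IfAll => //).
Qed.

Lemma ok_pFinal : ok set0 pFinal.
Proof.
have [[_ _ Uc _] _] := disjointness.
have HB : fresh set0 by move=> x _; rewrite inE.
rewrite /pFinal /= andbT; apply: ok_BigFor => // [x|B HB']; first by rewrite inE.
have [Hf Hcel] := fresh_cel HB HB'.
by apply: ok_pCat => s _; exact: (ok_pBit (ok_cell 0 s Hf (ok_top Hf) Hcel)).
Qed.

Theorem ok_pAccept : ok set0 pAccept.
Proof.
have [[Ul _ _ _] [/hasPn D1 /hasPn D2 /hasPn D3 _ _]] := disjointness.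
have HB : fresh set0 by move=> x _; rewrite inE.
have Ht := ok_top HB; have HBk r := ok_block r HB Ht.
have Hex r r' : ok set0 (pEx (aBlock aTop r) (aBlock aTop r')) by apply: ok_pEx.
have Hlev : ok set0 (BigFor lam pLevel).
  apply: ok_BigFor => // [x|B HB']; first by rewrite inE.
  apply: ok_pLevel => [x Hx|x Hx|x Hx]; rewrite HB' inE ?orbF ?Hx //.
  - apply/negP => Hl; have := D1 x Hl; have := D2 x Hl; rewrite !inE.
    by case/orP: Hx => ->.
  - by apply/negP => Hl; have := D3 x Hl; rewrite !inE Hx.
rewrite -[ok _ _]/(true && (ok set0 (pEx (aBlock aTop 2) (aBlock aTop 1)) && (true && (ok set0 pInit &&
  (ok set0 (pEx (aBlock aTop 1) (aBlock aTop 0)) && (true && (ok set0 pFinal && (ok set0 (BigFor lam pLevel) && ok set0 pStep)))))))).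
by rewrite !Hex ok_pInit ok_pFinal Hlev ok_pStep.
Qed.

(** * The text printed by the program *)

Variable w : seq bool.
Hypothesis size_lam' : size lam' = size lam.
Hypothesis size_cel' : size cel' = size cel.
Let v := labels w.
Let N := size v.
Let C := N ^ size cel.
Let L := N ^ size lam.
Let W := C * sg.
Notation evalp := (eval (None, false) v).

(* The input is written from cell [N ^ (size cel).-1 + 1] on: the cell indices with leading digit 1,
   followed by zeros and by a last digit that is the position of the symbol in [labels w]. *)
Definition init_sym (i : nat) : nat :=
  if N ^ (size cel).-1 < i < N ^ (size cel).-1 + N then
    match (nth (None, false) v (i - N ^ (size cel).-1)).1 with
    | Some (inr o) => s_head o
    | Some (inl b) => s_inp b
    | None => bl
    end
  else bl.

Definition emits A (e : env K) (n : nat) : Prop := forall u, evalp e (A u) = rep n u.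

Lemma eval_pDiv A e n : emits A e n -> evalp e (pDiv A) = enc_ctl (div_ctl n).
Proof. by move=> H; rewrite enc_div_ctl /= !H. Qed.

Lemma eval_pBit A e n : emits A e n -> evalp e (pBit A) = enc_ctl (bit_ctl n).
Proof. by move=> H; rewrite enc_bit_ctl -(eval_pDiv H). Qed.

Lemma eval_pEx A A' e n n' X : emits A e n -> emits A' e n' ->
  evalp e (pEx A A') ++ enc_ctl X = enc_ctl (ex_ctl n n' X).
Proof. by move=> H H'; rewrite enc_ex_ctl -(eval_pDiv H) -(eval_pDiv H') -!catA. Qed.

Lemma N_gt1 : 1 < N.
Proof. by rewrite /N /v size_labels. Qed.

Lemma is_firstE (e : env K) xs i : at_ v xs i e ->
  all (fun x => is_first (nth (None, false) v (e x))) xs = (i == 0).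
Proof.
move=> H; rewrite -(val_zero (ltnW N_gt1) H); apply: eq_in_all => x Hx.
have Hlt := allP H.1 x Hx; have := labels_none Hlt; rewrite /is_first -/v.
case: (nth _ _ _).1 => [y|] [H1 H2]; first by apply/esym/eqP => /H2.
by rewrite H1.
Qed.

Lemma is_lastE (e : env K) xs i : at_ v xs i e ->
  all (fun x => is_last (nth (None, false) v (e x))) xs = (i == (N ^ size xs).-1).
Proof.
move=> H; rewrite -(val_last (ltnW N_gt1) H); apply: eq_in_all => x Hx.
exact: labels_last (allP H.1 x Hx).
Qed.

Lemma emits_top e : emits aTop e (3 * L * W).
Proof.
move=> u; have [[_ Ul' _ Uc'] _] := disjointness.
rewrite /aTop (eval_BigFor (G := fun _ => rep (C * (3 * sg)) u)) // => [|e' i _ _ _].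
  by rewrite flatten_const size_iota size_lam' rep_rep -/L /W (mulnCA C) (mulnCA L) mulnA.
rewrite (eval_BigFor (G := fun _ => rep (3 * sg) u)) //.
by rewrite flatten_const size_iota size_cel' rep_rep.
Qed.

Lemma emits_zero e : emits aZero e (3 * 0 * W).
Proof. by []. Qed.

Lemma emits_level e i : at_ v lam i e -> i < L -> emits aLevel e (3 * (L.-1 - i) * W).
Proof.
move=> He Hi u; have [[_ Ul' _ Uc'] [D1 _ _ _ _]] := disjointness.
rewrite /aLevel (eval_BigFor (G := fun j => if i < j then rep (C * (3 * sg)) u else [::])) // => [|e' j Ha Hj _].
  by rewrite size_lam' flatten_gt // rep_rep -/L /W (mulnCA C) (mulnCA (L.-1 - i)) mulnA.
rewrite (eval_IfLt _ _ _ _ (at_agree Ha D1 He) Hj) //; case: ifP => // _.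
rewrite (eval_BigFor (G := fun _ => rep (3 * sg) u)) //.
by rewrite flatten_const size_iota size_cel' rep_rep.
Qed.

Lemma emits_block base e l r : emits base e (3 * l * W) -> emits (aBlock base r) e ((3 * l + r) * W).
Proof.
move=> H u; have [[_ _ _ Uc'] _] := disjointness.
rewrite /= H (eval_BigFor (G := fun _ => rep (r * sg) u)) //.
by rewrite flatten_const size_iota size_cel' rep_rep -rep_add -/C mulnDl (mulnCA C).
Qed.

Lemma emits_cell base e l r c s : emits base e (3 * l * W) -> at_ v cel c e -> c < C ->
  emits (aCell base r s) e ((3 * l + r) * W + (c * sg + s)).
Proof.
move=> H Hc Hlt u; have [[_ _ _ Uc'] [_ _ _ _ D]] := disjointness.
have HB := emits_block r H u.
rewrite /aCell [LHS]/= -[_ ++ evalp e (BigFor _ _)]/(evalp e (aBlock base r u)) HB.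
rewrite (eval_BigFor (G := fun j => if j < c then rep sg u else [::])) // => [|e' j Ha Hj _].
  by rewrite size_cel' flatten_lt ?(ltnW Hlt) // rep_rep -!rep_add.
by rewrite (eval_IfLt _ _ _ _ Hj (at_agree Ha D Hc)).
Qed.

Lemma emits_prev base e l r c s : emits base e (3 * l * W) -> at_ v cel c e -> c < C ->
  emits (aPrev base r s) e ((3 * l + r) * W + (c.-1 * sg + s)).
Proof.
move=> H Hc Hlt u; have [[_ _ _ Uc'] [_ _ _ _ D]] := disjointness.
have HB := emits_block r H u.
rewrite /aPrev [LHS]/= -[_ ++ evalp e (BigFor _ _)]/(evalp e (aBlock base r u)) HB.
rewrite (eval_BigFor (G := fun j => if j == 0 then [::] else if j < c then rep sg u else [::])) // => [|e' j Ha Hj _].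
  by rewrite size_cel' flatten_lt_pred ?(ltnW Hlt) // rep_rep -!rep_add.
rewrite eval_IfAll (is_firstE Hj); case: ifP => // _.
by rewrite (eval_IfLt _ _ _ _ Hj (at_agree Ha D Hc)).
Qed.

Lemma eval_pImp A A' e n n' : emits A e n -> emits A' e n' ->
  evalp e (pImp A A') = enc_ctl (imp_ctl (bit_ctl n) (bit_ctl n')).
Proof.
move=> H H'; rewrite -[LHS]/((neg_tag ++ and_tag) ++ evalp e (pBit A) ++ neg_tag ++ evalp e (pBit A')).
by rewrite (eval_pBit H) (eval_pBit H').
Qed.

Lemma eval_pIncl e i a b a' b' : at_ v lam i e -> i < L ->
  evalp e (pIncl a b a' b') =
  enc_ctl (incl_ctl sg C (3 * (L.-1 - i) + a) (3 * (L.-1 - i) + b)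
                         (3 * (L.-1 - i) + a') (3 * (L.-1 - i) + b')).
Proof.
move=> He Hi; have [[_ _ Uc _] [_ _ D _ _]] := disjointness.
rewrite /incl_ctl enc_conj enc_items_flatten /pIncl [LHS]/=; congr cat.
apply: eval_BigFor => // e' c Ha Hc Hlt.
rewrite eval_pCat enc_items_flatten -map_comp; congr flatten; apply/eq_in_map => s Hs.
have Hl := emits_level (at_agree Ha D He) Hi.
have Hcell r : emits (aCell aLevel r s) e' ((3 * (L.-1 - i) + r) * W + (c * sg + s)) by apply: emits_cell.
by rewrite enc_items2 -(eval_pImp (Hcell a) (Hcell b)) -(eval_pImp (Hcell a') (Hcell b')).
Qed.

(** All text of a level stands before its subformula [X], so [pLevel] prints an opening and the text
    of [X] simply follows. This is why the levels form a plain loop. *)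
Lemma eval_pLevel e i X : at_ v lam i e -> i < L ->
  evalp e pLevel ++ enc_ctl X = enc_ctl (level_ctl sg C (L.-1 - i) X).
Proof.
move=> He Hi; have Hl := emits_level He Hi; have HB r := emits_block r Hl.
rewrite /level_ctl -(eval_pEx _ (HB 3) (HB 2)).
set Y := halves_ctl sg C (L.-1 - i) X.
rewrite -[LHS]/((evalp e (pEx (aBlock aLevel 3) (aBlock aLevel 2)) ++ neg_tag ++
  evalp e (pEx (aBlock aLevel 2) (aBlock aLevel 1)) ++ evalp e (pEx (aBlock aLevel 1) (aBlock aLevel 0)) ++
  (and_tag ++ neg_tag ++ and_tag ++ neg_tag) ++
  evalp e (pIncl 1 4 2 0) ++ neg_tag ++ evalp e (pIncl 1 2 3 0) ++ neg_tag) ++ enc_ctl X).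
have EY : enc_ctl Y = and_tag ++ (neg_tag ++ and_tag ++ (neg_tag ++ evalp e (pIncl 1 4 2 0)) ++
    (neg_tag ++ evalp e (pIncl 1 2 3 0))) ++ neg_tag ++ enc_ctl X.
  by rewrite !(eval_pIncl _ _ _ _ He Hi) /Y /halves_ctl !enc_and !enc_neg.
have EX1 := eval_pEx Y (HB 1) (HB 0).
have EX2 := eval_pEx (ex_ctl ((3 * (L.-1 - i) + 1) * W) ((3 * (L.-1 - i) + 0) * W) Y) (HB 2) (HB 1).
by rewrite enc_neg -EX2 -EX1 EY -!catA.
Qed.

Lemma eval_pRule e c a b d : at_ v cel c e -> c < C ->
  evalp e (pRule a b d) = and_tag ++ enc_ctl (rule_ctl sg C delta c a b d).
Proof.
move=> Hc Hlt; have Hz := emits_zero e.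
have E1 := eval_pBit (emits_prev 1 a Hz Hc Hlt).
have E2 s := eval_pBit (emits_cell 1 s Hz Hc Hlt).
have E3 s := eval_pBit (emits_cell 0 s Hz Hc Hlt).
rewrite -[LHS]/((and_tag ++ neg_tag ++ and_tag) ++ evalp e (pBit (aPrev aZero 1 a)) ++ and_tag ++
  evalp e (pBit (aCell aZero 1 b)) ++ and_tag ++ evalp e (pBit (aCell aZero 1 (sg + d))) ++ neg_tag ++
  evalp e (pBit (aCell aZero 0 (delta a b d)))).
by rewrite E1 !E2 E3 /rule_ctl enc_neg !enc_and enc_neg -!catA.
Qed.

Lemma eval_pStep e : evalp e pStep = enc_ctl (step_ctl sg C bl delta).
Proof.
have [[_ _ Uc _] _] := disjointness.
rewrite /step_ctl enc_conj enc_items_flatten /pStep [LHS]/=; congr cat.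
apply: eval_BigFor => // e' c Ha Hc Hlt.
have Ebl := eval_pBit (emits_cell 0 bl (emits_zero e') Hc Hlt).
rewrite !eval_IfAll (is_firstE Hc) (is_lastE Hc) -/C /step_items.
have Ebord : evalp e' (Seq (Out and_tag) (pBit (aCell aZero 0 bl))) = enc_items [:: cell_ctl sg C 0 c bl].
  by rewrite enc_items1 -[LHS]/(and_tag ++ evalp e' (pBit (aCell aZero 0 bl))) Ebl.
case: eqP => _ /=; first exact: Ebord.
case: eqP => _ /=; first exact: Ebord.
rewrite eval_pCat enc_items_flatten -map_comp; congr flatten; apply/eq_map => a.
rewrite [LHS]eval_pCat enc_items_flatten -map_comp; congr flatten; apply/eq_map => b.
rewrite [LHS]eval_pCat enc_items_map -map_comp; congr flatten; apply/eq_map => d.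
exact: eval_pRule.
Qed.

Lemma val_from_add (e : env K) a xs : val_from v e a xs = a * N ^ size xs + val_from v e 0 xs.
Proof.
elim: xs a => [|x xs IH] a; first by rewrite muln1 addn0.
have E b : val_from v e b (x :: xs) = val_from v e (b * N + e x) xs by [].
by rewrite !E (IH (a * N + e x)) (IH (0 * N + e x)) mul0n add0n /= expnS mulnDl -mulnA addnA.
Qed.

(** With the index split into leading digit, middle digits and last digit, the interval in
    [init_sym] means leading digit 1, middle digits 0 and a nonzero last digit; last digit 0 is
    caught by its label [None]. *)
Lemma init_symE e i body : at_ v cel i e ->
  evalp e (pInitCell body) = evalp e (body (init_sym i)).
Proof.
move=> [Hall Hi]; move: Hall; rewrite celE /= all_rcons => /and3P [H1 Hcl Hmid].
have Hpow : (size cel).-1 = (size cmid).+1 by rewrite celE /= size_rcons.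
have Ei : i = e c1 * N ^ (size cmid).+1 + val_from v e 0 cmid * N + e cl.
  have E0 : val_from v e 0 (c1 :: rcons cmid cl) = val_from v e (e c1) cmid * N + e cl.
    by rewrite /val_from /= foldl_rcons mul0n.
  by rewrite -Hi celE E0 val_from_add mulnDl -mulnA -expnSr.
have Hmid0 : at_ v cmid (val_from v e 0 cmid) e by [].
have Hc1 : is_head (nth (None, false) v (e c1)) = (e c1 == 1).
  exact: labels_head.
rewrite /pInitCell /= Hc1 (eval_IfAll _ _ is_first cmid) (is_firstE Hmid0) /init_sym Hpow.
have HN := N_gt1; have Hexp : N <= N ^ (size cmid).+1.
  by rewrite expnS -{1}[N]muln1 leq_mul2l expn_gt0 (ltnW HN) orbT.
case: (eqVneq (e c1) 1) => E1; last first.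
  rewrite ifF //; apply/negbTE; rewrite Ei.
  have Hb := @val_bounds _ _ v e 0 cmid Hmid; rewrite mul0n mul1n in Hb; case/andP: Hb => _ Hb.
  have Hm : (val_from v e 0 cmid).+1 * N <= N ^ (size cmid).+1 by rewrite expnSr leq_mul2r Hb orbT.
  case: (e c1) E1 => [_|[//|k _]]; first rewrite mul0n add0n ltnNge.
    by rewrite (leq_trans _ Hm) // mulSn [N + _]addnC leq_add2l ltnW.
  by rewrite !mulSn -!addnA ltn_add2l [X in _ && X]ltnNge (leq_trans Hexp (leq_addr _ _)) andbF.
rewrite E1 mul1n in Ei.
case: (posnP (val_from v e 0 cmid)) => E0; last first.
  rewrite ifF //; apply/negbTE; rewrite Ei.
  move: E0; case: (val_from v e 0 cmid) => // k _.
  by rewrite mulSn -!addnA ltn_add2l [X in _ && X]ltnNge leq_addr andbF.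
rewrite E0 addn0 in Ei; rewrite Ei ltn_add2l Hcl andbT.
have -> : N ^ (size cmid).+1 + e cl - N ^ (size cmid).+1 = e cl by rewrite addKn.
rewrite /= -[X in X < _]addn0 ltn_add2l.
have := labels_none Hcl; rewrite -/v.
case: (nth _ _ _).1 => [y|] [Ha Hb]; last by rewrite (Ha erefl).
have -> : 0 < e cl by rewrite lt0n; apply/eqP => /Hb.
by case: y {Ha Hb} => [[]|[[]|]].
Qed.

Lemma eval_pInit e : evalp e pInit = enc_ctl (init_ctl sg C L init_sym).
Proof.
have [[_ _ Uc _] _] := disjointness.
rewrite /init_ctl enc_conj enc_items_map /pInit [LHS]/=; congr cat.
apply: eval_BigFor => // e' c Ha Hc Hlt.
rewrite (init_symE _ Hc) -[LHS]/(and_tag ++ evalp e' (pBit (aCell aTop 1 (init_sym c)))).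
by rewrite (eval_pBit (emits_cell 1 _ (emits_top e') Hc Hlt)).
Qed.

Lemma eval_pFinal e : evalp e pFinal = enc_ctl (final_ctl sg C L bad).
Proof.
have [[_ _ Uc _] _] := disjointness.
rewrite /final_ctl enc_conj enc_items_flatten /pFinal [LHS]/=; congr cat.
apply: eval_BigFor => // e' c Ha Hc Hlt.
rewrite eval_pCat enc_items_map -map_comp; congr flatten; apply/eq_map => s.
rewrite -[LHS]/((and_tag ++ neg_tag) ++ evalp e' (pBit (aCell aTop 0 s))).
by rewrite (eval_pBit (emits_cell 0 _ (emits_top e') Hc Hlt)).
Qed.

Lemma enc_reach (f : nat -> seq bool) l e :
  (forall i X, i < l -> f i ++ enc_ctl X = enc_ctl (level_ctl sg C (l.-1 - i) X)) ->
  flatten [seq f i | i <- iota 0 l] ++ evalp e pStep = enc_ctl (reach_ctl sg C bl delta l).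
Proof.
elim: l f => [|l IH] f Hf; first exact: eval_pStep.
rewrite /= -[1]/(1 + 0) iotaDl -map_comp -catA.
rewrite (IH (f \o addn 1)); first by rewrite Hf // subn0.
move=> i X Hi /=; rewrite Hf //; congr (enc_ctl (level_ctl _ _ _ _)); lia.
Qed.

Lemma level_prefix l : exists s, forall X, enc_ctl (level_ctl sg C l X) = s ++ enc_ctl X.
Proof.
eexists => X; rewrite /level_ctl enc_ex_ctl enc_neg !enc_ex_ctl /halves_ctl enc_and [enc_ctl (CNeg X)]enc_neg !catA.
by [].
Qed.

Lemma eval_levels e : evalp e (BigFor lam pLevel) ++ evalp e pStep = enc_ctl (reach_ctl sg C bl delta L).
Proof.
have [[Ul _ _ _] _] := disjointness.
(* The opening of a level is the same for all subformulas, so it is recovered by cutting a sample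
   subformula [t] off the end. *)
pose t := CAtom Lt; pose level_of i := enc_ctl (level_ctl sg C (L.-1 - i) t).
pose f i := take (size (level_of i) - size (enc_ctl t)) (level_of i).
rewrite (eval_BigFor (G := f)) // => [|e' i _ Hi Hlt].
- apply: enc_reach => i X Hi; rewrite /f /level_of; have [s Hs] := level_prefix (L.-1 - i).
  by rewrite !Hs size_cat addnK take_size_cat.
- by rewrite /f /level_of -(eval_pLevel t Hi Hlt) size_cat addnK take_size_cat.
Qed.

Theorem eval_pAccept e : evalp e pAccept =
  enc_instance (accept_ctl sg C bl delta L init_sym bad) Ltb 0.
Proof.
have Ht := emits_top e; have HB r := emits_block r Ht.
rewrite /enc_instance catA -[LHS]/((enc_unary (loc_code Ltb) ++ enc_nat 0) ++
  evalp e (pEx (aBlock aTop 2) (aBlock aTop 1)) ++ and_tag ++ evalp e pInit ++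
  evalp e (pEx (aBlock aTop 1) (aBlock aTop 0)) ++ and_tag ++ evalp e pFinal ++
  evalp e (BigFor lam pLevel) ++ evalp e pStep).
by rewrite eval_levels eval_pInit eval_pFinal /accept_ctl -(eval_pEx _ (HB 2) (HB 1)) enc_and
   -(eval_pEx _ (HB 1) (HB 0)) enc_and.
Qed.

End Generator.

(** * The reduction *)

Lemma enc_unary_inj a b r r' : enc_unary a ++ r = enc_unary b ++ r' -> a = b /\ r = r'.
Proof. by elim: a b => [|a IH] [|b] //= [] // /IH [-> ->]. Qed.

Lemma loc_code_inj q q' : loc_code q = loc_code q' -> q = q'.
Proof. by case: q; case: q'. Qed.

(** The encoding is a prefix code; carrying the remainders [r] and [r'] lets the induction separate
    consecutive arguments. *)
Lemma enc_ctl_inj X Y r r' : enc_ctl X ++ r = enc_ctl Y ++ r' -> X = Y /\ r = r'.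
Proof.
elim: X Y r r' => [p|a IHa|a IHa b IHb|a IHa|a IHa b IHb|a IHa b IHb] [p'|a'|a' b'|a'|a' b'|a' b'] r r' //=.
- by case=> /enc_unary_inj [/loc_code_inj -> ->].
- by case=> /IHa [-> ->].
- by rewrite -!catA => -[] /IHa [-> /IHb [-> ->]].
- by case=> /IHa [-> ->].
- by rewrite -!catA => -[] /IHa [-> /IHb [-> ->]].
- by rewrite -!catA => -[] /IHa [-> /IHb [-> ->]].
Qed.

Lemma CTL_MC_instance X q : CTL_MC (enc_instance X q 0) <-> sat X (q, 0).
Proof.
split=> [[Y [q' [n [E H]]]]|H]; last by exists X, q, 0.
move: E; rewrite /enc_instance => /enc_unary_inj [/loc_code_inj -> E].
(* Only 0 has a code that starts with [false]. *)
have En : n = 0 by move: E; rewrite /enc_nat; case: n {H} => //= n; case: (enc_pos _).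
move: E; rewrite En => -[E].
have [-> _] := @enc_ctl_inj X Y [::] [::] (congr1 (cat^~ [::]) E).
by rewrite En in H.
Qed.

Lemma split_marks a b : exists (K : finType) (l1 l2 l3 l4 : seq K),
  [/\ uniq (l1 ++ l2 ++ l3 ++ l4), size l1 = a, size l2 = a, size l3 = b & size l4 = b].
Proof.
pose e := enum 'I_(a + (a + (b + b))).
exists 'I_(a + (a + (b + b))), (take a e), (take a (drop a e)),
  (take b (drop a (drop a e))), (drop b (drop a (drop a e))).
have He : size e = a + (a + (b + b)) by rewrite size_enum_ord.
split; rewrite ?cat_take_drop ?enum_uniq // ?size_takel ?size_drop ?He; lia.
Qed.

Lemma nth_labels w j : j.+1 < size (labels w) -> (nth (None, false) (labels w) j.+1).1 =
  if j is j'.+1 then Some (inl (nth false (behead w) j')) else Some (inr (ohead w)).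
Proof.
move=> Hj; rewrite -(nth_map _ None) // labels_fst; move: Hj; rewrite size_labels.
by case: j => [|j] //= Hj; rewrite (nth_map false) // size_behead; lia.
Qed.

(** Position [j] of [labels w] belongs to cell [B + j], so the head starts on cell [B + 1], at the
    label of the first input bit. *)
Lemma init_cells (M : TM) (K : finType) (cel : seq K) w i :
  init_sym (code (cblank M)) cel
    (fun o => code (if o is Some b then tm_inp M b else tm_blank M, Some (tm_start M)))
    (fun b => code (tm_inp M b, None)) w i =
  code (cell_of (tm_init M w) (size (labels w) ^ (size cel).-1).+1 i).
Proof.
rewrite /init_sym; set B := _ ^ _; set c0 := tm_init M w.
have Hl : cf_left c0 = [::] by rewrite /c0; case: (w).
have Hr : cf_right c0 = map (tm_inp M) (behead w) by rewrite /c0; case: (w).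
have Hh : cf_head c0 = if ohead w is Some b then tm_inp M b else tm_blank M by rewrite /c0; case: (w).
have Hs : cf_st c0 = tm_start M by rewrite /c0; case: (w).
case: (leqP i B) => HiB /=.
  by rewrite cell_of_blank // Hl; left; rewrite subn0 ltnS.
case: (ltnP i (B + size (labels w))) => HiN; last first.
  by rewrite cell_of_blank // Hr size_map size_behead; right; move: HiN; rewrite size_labels; lia.
have [j Ej] : exists j, i = B + j.+1 by exists (i - B).-1; lia.
have -> : i - B = j.+1 by lia.
rewrite nth_labels; last by lia.
rewrite /cell_of /content Hl Hr Hh Hs; case: j Ej => [|j] Ej.
  by rewrite Ej addn1 ltnn eqxx.
have -> : (i < B.+1) = false by lia.
have -> : (i == B.+1) = false by lia.
have -> : (i - B.+1).-1 = j by lia.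
by rewrite (nth_map false) // size_behead; move: HiN; rewrite size_labels; lia.
Qed.

Lemma iter_ca_ext C bl delta f g n : f =1 g -> iter n (ca C bl delta) f =1 iter n (ca C bl delta) g.
Proof. by move=> E; elim: n => //= n IH; apply: ca_ext. Qed.

(** The left side is less than [N ^ k * (2 * a + 3)], and [2 * a + 3 <= 2 ^ (a + 4)]. *)
Lemma window_large a k n N : n < N -> 1 < N -> a * n ^ k + a + 2 < N ^ (k + a + 4).
Proof.
move=> Hn HN; rewrite -[k + a + 4]addnA expnD.
have H1 : n ^ k <= N ^ k by case: (k) => // k'; rewrite leq_exp2r // ltnW.
have H2 : 2 * a + 3 <= N ^ (a + 4).
  apply: leq_trans (_ : 2 ^ (a + 4) <= _); last by rewrite leq_exp2r // addn4.
  by elim: a => // a IH; rewrite addSn expnS; lia.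
have H3 : 0 < N ^ k by rewrite expn_gt0 ltnW.
have H4 : N ^ k * (2 * a + 3) <= N ^ k * N ^ (a + 4) by rewrite leq_mul2l H2 orbT.
have H5 : a * n ^ k <= a * N ^ k by rewrite leq_mul2l H1 orbT.
have H6 : a <= a * N ^ k by rewrite leq_pmulr.
apply: leq_trans H4; rewrite mulnDr mulnCA [N ^ k * a]mulnC; lia.
Qed.

Theorem theorem3 : PSPACE_hard CTL_MC.
Proof.
move=> L' [M [a [k HM]]].
(* By [window_large], [k + a + 4] digits exceed the space bound; one more digit leaves that much
   room on both sides of the start. The factor [N ^ #|csym M|] between the number of levels and that
   of cells is at least [#|csym M|], as the time bound requires. *)
pose s2 := k + a + 5; pose s1 := s2 + #|csym M|.
have [K [lam [lam' [cel [cel' [Hu E1 E2 E3 E4]]]]]] := split_marks s1 s2.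
have [c1 [cmid [cl Hcel]]] : exists c1 cmid cl, cel = c1 :: rcons cmid cl.
  case: cel E3 {Hu} => [|c1 l]; first by rewrite /s2 addnS.
  case/lastP: l => [|cmid cl]; first by rewrite /s2 !addnS.
  by move=> _; exists c1, cmid, cl.
pose bl := code (cblank M).
pose s_head (o : option bool) := code (if o is Some b then tm_inp M b else tm_blank M, Some (tm_start M)).
pose s_inp b := code ((tm_inp M b, None) : csym M).
pose p := pAccept #|csym M| bl (@delta_code M) (@rejecting M) lam lam' cel cel' c1 cmid cl s_head s_inp.
exists (fun w => eval (None, false) (labels w) [ffun=> size (labels w)] p); split.
  exact: prog_poly_time (ok_pAccept _ _ _ _ Hcel Hu _ _).
move=> w; have [Hhalt [Hspace HL]] := HM w.
rewrite HL eval_pAccept // ?E1 ?E2 ?E3 ?E4 // CTL_MC_instance.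
set N := size (labels w); set C := N ^ s2; set L := N ^ s1.
have HN : size w < N by rewrite /N size_labels; lia.
have HN1 : 1 < N by rewrite /N size_labels.
pose S := a * size w ^ k + a; pose B := N ^ (size cel).-1.
have Es2 : s2 = (k + a + 4).+1 by rewrite /s2 addnS.
have HSB : S + 2 < B by rewrite /B E3 Es2; exact: window_large.
have HBC : B + B <= C by rewrite addnn -mul2n /C /B E3 Es2 expnS leq_mul2r HN1 orbT.
have HCL : C * #|csym M| <= L.
  rewrite /L /s1 expnD leq_mul2l; apply/orP; right; apply: ltnW.
  by apply: leq_trans (ltn_expl _ (ltnSn 1)) _; case: #|csym M| => // m; rewrite leq_exp2r.
rewrite (ca_accepts (p0 := B.+1) Hspace _ _ HCL Hhalt) -/S; try lia.
rewrite accept_spec //.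
- have E : init_sym bl cel s_head s_inp w =1 fun i => code (cell_of (tm_init M w) B.+1 i) by move=> i; exact: init_cells.
  by split=> H i /H; rewrite (iter_ca_ext _ _ _ _ E).
- exact: code_lt.
- by move=> *; exact: code_lt.
- by move=> c; rewrite init_cells; exact: code_lt.
Qed.
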